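(* Let $N\in\mathbb{Z}$ with $|N|>1$ and let $\mathcal{D}$ be a finite set of integers. Let $\mathcal{S}\subset\mathbb{Z}$ be such that $0\in\mathcal{S}$ and $(\frac{1}{N}\mathcal{D},\mathcal{S})$ is a compatible pair. Then the self-similar measure $\mu_{N,\mathcal{D}}$ is a spectral measure. If moreover $\gcd(\mathcal{D}-\mathcal{D})=1$, $0\in\mathcal{S}$ and $\mathcal{S}\subseteq[2-|N|,|N|-2]$, then $\Lambda(N,\mathcal{S})$ is a spectrum for $\mu_{N,\mathcal{D}}$.
   Context: Write $e(t)=e^{2\pi i t}$. A probability measure $\mu$ on $\mathbb{R}$ is called a spectral measure if there exists a set $\Lambda\subset\mathbb{R}$ such that the functions $t\mapsto e(\lambda t)$, $\lambda\in\Lambda$, form an orthonormal basis of $L^2(\mu)$; such a $\Lambda$ is called a spectrum for $\mu$. For an integer $N$ with $|N|>1$ and a finite set $\mathcal{D}=\{d_1,\dots,d_q\}\subset\mathbb{Z}$ of cardinality $q$, $\mu_{N,\mathcal{D}}$ denotes the unique Borel probability measure on $\mathbb{R}$ satisfying $\mu=\sum_{j=1}^q \frac1q\,\mu\circ\phi_j^{-1}$, where $\phi_j(x)=\frac1N(x+d_j)$. Two finite sets $\mathcal{A}=\{a_1,\dots,a_q\}$ and $\mathcal{S}=\{s_1,\dots,s_q\}$ of real numbers, both of cardinality $q$, form a compatible pair $(\mathcal{A},\mathcal{S})$ if the $q\times q$ matrix $\left[\frac{1}{\sqrt q}e(a_js_k)\right]_{j,k}$ is unitary. Here $\frac1N\mathcal{D}=\{d/N: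 d\in\mathcal{D}\}$. For a finite set $\mathcal{A}\subset\mathbb{R}$, $\Lambda(N,\mathcal{A})=\left\{\sum_{j=0}^k a_jN^j:\ k\ge 1,\ a_j\in\mathcal{A}\right\}$. $\mathcal{D}-\mathcal{D}=\{d-d': d,d'\in\mathcal{D}\}$, and the gcd of a set of integers is the greatest common divisor of all its elements. *)

(* Defs.v *)
From HB Require Import structures.
From mathcomp Require Import all_boot all_order all_algebra.
From mathcomp Require Import spectral finmap complex.
From mathcomp Require Import all_classical all_reals all_analysis.

Set Implicit Arguments.
Unset Strict Implicit.
Unset Printing Implicit Defensive.

Import Order.TTheory GRing.Theory Num.Theory.
Import numFieldNormedType.Exports.

Local Open Scope classical_set_scope.
Local Open Scope fset_scope.
Local Open Scope complex_scope.
Local Open Scope ring_scope.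

Definition cis2pi {R : realType} (t : R) : R[i] :=
  cos (2 * pi * t) +i* sin (2 * pi * t).

(* Complex functions are given by representatives; a complex function is
   Borel measurable iff its real and imaginary parts are.  [Normc.normc]
   is the modulus with values in [R] (while [`|z|] has values in [R[i]]). *)

Definition L2norm {R : realType} (mu : probability (measurableTypeR R) R)
    (f : R -> R[i]) : \bar R :=
  Lnorm mu 2%:E (fun x => (Normc.normc (f x))%:E).

Definition in_L2 {R : realType} (mu : probability (measurableTypeR R) R)
    (f : R -> R[i]) : Prop :=
  [/\ measurable_fun [set: measurableTypeR R] (fun x => complex.Re (f x)),
      measurable_fun [set: measurableTypeR R] (fun x => complex.Im (f x)) &
      (L2norm mu f < +oo)%E].

Definition L2dot {R : realType} (mu : probability (measurableTypeR R) R)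
    (f g : R -> R[i]) : R[i] :=
  (\int[mu]_x complex.Re (f x * conjc (g x)))
    +i* (\int[mu]_x complex.Im (f x * conjc (g x))).

Definition orthonormal_basis {R : realType} {I : choiceType}
    (mu : probability (measurableTypeR R) R)
    (L : set I) (u : I -> R -> R[i]) : Prop :=
  [/\ forall i, L i -> in_L2 mu (u i),
      forall i j, L i -> L j -> L2dot mu (u i) (u j) = (i == j)%:R &
      forall f, in_L2 mu f -> forall eps : R, 0 < eps ->
        exists (s : {fset I}) (c : I -> R[i]),
          (forall i, i \in s -> L i) /\
          (L2norm mu (fun x => f x - \sum_(i <- s) c i * u i x)%R < eps%:E)%E].

Definition is_spectrum {R : realType} (mu : probability (measurableTypeR R) R)
    (L : set R) : Prop :=
  orthonormal_basis mu L (fun lambda t => cis2pi (lambda * t)).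

Definition spectral_measure {R : realType}
    (mu : probability (measurableTypeR R) R) : Prop :=
  exists L : set R, is_spectrum mu L.

Definition phi {R : realType} (N d : int) (x : measurableTypeR R) :
    measurableTypeR R :=
  (N%:~R : R)^-1 * ((x : R) + d%:~R).

(* Characterizes mu_{N,D}: for |N| > 1 and D nonempty there is exactly one such
   Borel probability measure. *)
Definition is_self_similar {R : realType} (N : int) (D : {fset int})
    (mu : probability (measurableTypeR R) R) : Prop :=
  forall A : set (measurableTypeR R), measurable A ->
    (mu A = \sum_(d <- D) (#|` D|%:R^-1)%:E * pushforward mu (phi N d) A)%E.

Definition compatible_pair {R : realType} (A S : {fset R}) : Prop :=
  #|` A| = #|` S| /\
  (\matrix_(j < #|` A|, k < #|` S|)
     ((Num.sqrt (#|` A|%:R : R))^-1%:C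
        * cis2pi ((enum_fset A)`_j * (enum_fset S)`_k))) \is unitarymx.

Definition fset_of_ints (R : realType) (S : {fset int}) : {fset R} :=
  [fset (s%:~R : R) | s in S].

Definition fset_scaled (R : realType) (N : int) (D : {fset int}) : {fset R} :=
  [fset (d%:~R / N%:~R : R) | d in D].

Definition Lambda {R : realType} (N : int) (A : {fset R}) : set R :=
  [set x | exists k : nat, exists2 a : 'I_k.+1 -> R,
     (1 <= k)%N /\ (forall j, a j \in A) &
     x = \sum_(j < k.+1) a j * N%:~R ^+ j].

Definition diff_fset (D : {fset int}) : {fset int} :=
  [fset d - d' | d in D, d' in D].

Definition gcd_fset (A : {fset int}) : int := \big[gcdz/0]_(a <- A) a.

(* Main.v *)
Require Import Defs.
From mathcomp Require Import all_boot all_order all_algebra.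
From mathcomp Require Import finmap complex spectral.
From mathcomp Require Import all_classical all_reals all_analysis.
From mathcomp Require Import measurable_realfun.
From mathcomp Require Import ring lra zify.

Set Implicit Arguments.
Unset Strict Implicit.
Unset Printing Implicit Defensive.

Import Order.TTheory GRing.Theory Num.Theory.
Import numFieldNormedType.Exports.

Local Open Scope classical_set_scope.
Local Open Scope ring_scope.

(* Let m(t) = (1/q) sum_d e(d t) and let ft be the Fourier transform of mu, so
   that ft(t) = m(t/N) ft(t/N).  Compatibility says that the weights
   |m((x + s)/N)|^2, s in S, add up to 1; since |m| is periodic under the lattice
   dual to D - D, the exponentials with frequencies in Lambda(N, S) are
   orthonormal, and Q(x) = sum_lambda |ft(x + lambda)|^2 is harmonic:
   Q(x) = sum_s |m((x + s)/N)|^2 Q((x + s)/N).  By Parseval, e(x t) lies in the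
   closed span of the exponentials iff Q(-x) = 1.

   If the digits are small, the maps x |-> (x + s)/N preserve a compact interval
   around 0 whose only point of the dual lattice is 0.  Let E be the set of
   minimizers of Q in it.  By harmonicity, E contains every (x + s)/N with x in E
   and m((x + s)/N) <> 0.  If E is infinite, then, as m has finitely many zeros in
   a bounded interval and 0 is a digit, x/N^k is in E for arbitrarily large k and
   suitable x, so 0 is in E and Q >= Q(0) = 1.  If E is finite, some point of E has a
   single successor y, because distinct digit words lead to distinct points;
   then |m(y)| = 1, so y is in the dual lattice and y = 0.  Hence Q = 1 on the
   interval, and on the whole line by contraction.

   Finally the exponentials e(x t), x real, span a dense subspace of L^2(mu) for
   every probability measure mu: indicators of rays are bounded pointwise limits
   of trigonometric polynomials. *)

(** * The transfer operator *)

Section words.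
Variables (R : realType) (N : R) (S : seq R).

Fixpoint words (n : nat) : seq (seq R) :=
  if n is m.+1 then [seq s :: w | s <- S, w <- words m] else [:: [::]].

(** Words carry the lowest digit first, the order in which [walk] applies its contractions; hence
    the closed form [walkE]. *)
Fixpoint lam (w : seq R) : R := if w is s :: w' then s + N * lam w' else 0.

Fixpoint walk (x : R) (w : seq R) : R :=
  if w is s :: w' then walk ((x + s) / N) w' else x.

Lemma walkE (hN : N != 0) x w : walk x w = (x + lam w) / N ^+ size w.
Proof.
elim: w x => [|s w IH] x /=; first by rewrite expr0 divr1 addr0.
rewrite IH exprS; field.
by rewrite expf_eq0 negb_and hN orbT.
Qed.

Lemma mem_words n w :
  (w \in words n) = (size w == n) && all (mem S) w.
Proof.
elim: n w => [|n IH] [|s w] //=.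
  by apply/allpairsP => -[[? ?] []].
rewrite eqSS; apply/allpairsP/idP => [[[t v] /= [tS vW [-> ->]]]|].
  by rewrite tS -IH.
move=> /and3P[sz sS wS]; exists (s, w) => /=; split => //.
by rewrite IH sz.
Qed.

Lemma words_uniq n : uniq S -> uniq (words n).
Proof.
move=> uS; elim: n => //= n IH.
by apply: allpairs_uniq => // -[a b] [c d] _ _ /= [-> ->].
Qed.

End words.

(* M stands for |m|^2 and G for |ft|^2; the lattice of periods P and the window
   parameter u are kept abstract so that N^2 can be used in place of N. *)
Section transfer.
Variables (R : realType) (N : R) (S : seq R) (M G : R -> R) (u : R).
Variable P : R -> Prop.
Hypothesis N2 : 2 <= `|N|.
Hypothesis u0 : 0 < u.
Hypothesis S0 : 0 \in S.
Hypothesis P0 : P 0.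
Hypothesis PB : forall x y, P x -> P y -> P (x - y).
Hypothesis PN : forall x, P x -> P (N * x).
Hypothesis SP : {in S, forall s, P s}.
Hypothesis M_ge0 : forall x, 0 <= M x.
Hypothesis M0 : M 0 = 1.
Hypothesis MP : forall x p, P p -> M (x + p) = M x.
Hypothesis Msum : forall x, \sum_(s <- S) M ((x + s) / N) = 1.
Hypothesis M_cts : continuous M.
Hypothesis G_ge0 : forall x, 0 <= G x.
Hypothesis G0 : G 0 = 1.
Hypothesis G_le1 : forall x, G x <= 1.
Hypothesis GM : forall x, G x = M (x / N) * G (x / N).
Hypothesis G_cts : continuous G.

(** Iterates of the transfer operator on [G]. [QE] identifies them with partial Parseval sums over
    the digit words of length [n]. *)
Fixpoint Q (n : nat) (x : R) : R :=
  if n is m.+1 then \sum_(s <- S) M ((x + s) / N) * Q m ((x + s) / N) else G x.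

Let N_gt0 : 0 < `|N|. Proof. by apply: lt_le_trans N2. Qed.
Let N_gt1 : 1 < `|N|. Proof. by apply: lt_le_trans N2; rewrite ltr1n. Qed.
Let N_neq0 : N != 0. Proof. by rewrite -normr_gt0. Qed.

Let PD x y : P x -> P y -> P (x + y).
Proof.
move=> px py; rewrite -[y]opprK; apply: PB => //.
by rewrite -sub0r; apply: PB.
Qed.

(** * Orthogonality of digit sums *)

Lemma lamP w : all (mem S) w -> P (lam N w).
Proof.
elim: w => [|s w IH] //= /andP[sS /IH h]; apply: PD; first exact: SP.
exact: PN.
Qed.

(** A repeated digit [s] would contribute [M 0 = 1] twice to the sum [Msum] taken at [- s]. *)
Lemma digits_uniq : uniq S.
Proof.
apply: count_mem_uniq => s; case: (boolP (s \in S)) => [sS|]; last first.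
  by move=> sS; apply/eqP; rewrite -leqn0 leqNgt -has_count has_pred1.
apply/eqP; rewrite eqn_leq -has_count has_pred1 sS andbT -(ler_nat R).
apply: le_trans (_ : \sum_(t <- S) M ((- s + t) / N) <= _); last by rewrite Msum.
rewrite (bigID (pred1 s)) /= -[leLHS]addr0 lerD ?sumr_ge0 //.
rewrite (eq_bigr (fun=> 1)) => [|t /eqP ->]; last by rewrite addNr mul0r M0.
by rewrite big_const_seq iter_addr_0.
Qed.

Let uS := digits_uniq.

(** In the sum [Msum] at [- t], the digit [t] alone contributes 1, so the other terms, being
    nonnegative, vanish. *)
Lemma M_digits s t : s \in S -> t \in S -> s != t -> M ((s - t) / N) = 0.
Proof.
move=> sS tS st; have := Msum (- t).
rewrite (bigD1_seq t) //= addNr mul0r M0.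
rewrite -big_filter (bigD1_seq s) /=; last 2 first.
- by rewrite mem_filter st.
- exact: filter_uniq.
rewrite [- t + s]addrC => /(congr1 (fun z => z - 1)); rewrite addrAC subrr add0r.
move/eqP; rewrite paddr_eq0 ?M_ge0 ?sumr_ge0 //.
by case/andP => /eqP.
Qed.

(** The functional equation strips the lowest digits, and the remaining ones only shift the argument
    of [M] by a period. If the lowest digits differ, [M_digits] kills the first factor; if they
    agree, induction kills the second. *)
Lemma G_lam w v : size w = size v -> all (mem S) w -> all (mem S) v ->
  w != v -> G (lam N w - lam N v) = 0.
Proof.
elim: w v => [|s w IH] [|t v] //= [sz] /andP[sS wS] /andP[tS vS].
rewrite eqseq_cons negb_and => /orP hne.
have PP : P (lam N w - lam N v) by apply: PB; apply: lamP.
rewrite GM; set y := (_ / N).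
have -> : y = (s - t) / N + (lam N w - lam N v) by rewrite /y; field.
rewrite MP //; have [est|nst] := eqVneq s t; last by rewrite M_digits ?mul0r.
case: hne => [|wv]; first by rewrite est eqxx.
by rewrite est subrr mul0r add0r IH // mulr0.
Qed.

(** Equal sums of distinct words would give [G 0 = 0] in [G_lam], against [G 0 = 1]. *)
Lemma lam_inj w v : size w = size v -> all (mem S) w -> all (mem S) v ->
  lam N w = lam N v -> w = v.
Proof.
move=> sz wS vS h; apply/eqP; apply: contraT => /(G_lam sz wS vS).
by rewrite h subrr G0 => /eqP; rewrite oner_eq0.
Qed.

(** * Iterates of the transfer operator and their limit *)

Lemma QE n x : Q n x = \sum_(w <- words S n) G (x + lam N w).
Proof.
elim: n x => [|n IH] x /=; first by rewrite big_seq1 /= addr0.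
rewrite big_allpairs_dep /=; apply: eq_bigr => s _.
rewrite IH mulr_sumr big_seq [RHS]big_seq; apply: eq_bigr => w.
rewrite mem_words => /andP[_ wS].
rewrite [in RHS]GM.
(* After division by [N], the higher digits form a period of [M]. *)
have -> : (x + (s + N * lam N w)) / N = (x + s) / N + lam N w by field.
by rewrite MP //; apply: lamP.
Qed.

Lemma Q_cts n : continuous (Q n).
Proof.
elim: n => [|n IH] /=; first exact: G_cts.
move=> x; apply: cvg_big; [exact: add_continuous|move=> s _].
have h : (fun y => (y + s) / N) y @[y --> x] --> (x + s) / N.
  apply: cvgM; last exact: cvg_cst.
  by apply: cvgD; [exact: cvg_id|exact: cvg_cst].
apply: cvgM; apply: continuous_cvg => //; [exact: M_cts|exact: IH].
Qed.

Lemma Q_le1 n x : Q n x <= 1.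
Proof.
elim: n x => [|n IH] x /=; first exact: G_le1.
rewrite -(Msum x); apply: ler_sum => s _.
by rewrite ler_piMr.
Qed.

Lemma Q_ge0 n x : 0 <= Q n x.
Proof. by rewrite QE sumr_ge0. Qed.

(** The digit 0 alone already returns [G x], by the functional equation, so the first iterate
    dominates [G]; the operator preserves order. *)
Lemma Q_homo x : nondecreasing_seq (Q^~ x).
Proof.
apply/nondecreasing_seqP => n; elim: n x => [|n IH] x; last first.
  by apply: ler_sum => s _; rewrite ler_wpM2l.
rewrite /= (bigD1_seq 0) //= addr0 -GM lerDl sumr_ge0 // => s _.
by rewrite mulr_ge0.
Qed.

Let L x := limn (Q^~ x).

Lemma Q_cvg x : Q^~ x @ \oo --> L x.
Proof.
apply: nondecreasing_is_cvgn; first exact: Q_homo.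
by exists 1 => _ [n _ <-]; exact: Q_le1.
Qed.

Lemma Q_leL n x : Q n x <= L x.
Proof. by apply: nondecreasing_cvgn_le; [exact: Q_homo|exact: Q_cvg]. Qed.

Lemma L_leP x c : (forall n, Q n x <= c) -> L x <= c.
Proof. by move=> h; apply: limr_le; [exact: Q_cvg|exact: nearW]. Qed.

Lemma L_step x : L x = \sum_(s <- S) M ((x + s) / N) * L ((x + s) / N).
Proof.
have h1 : Q n.+1 x @[n --> \oo] --> L x.
  by have := @Q_cvg x; rewrite -cvg_shiftS.
apply: (cvg_unique _ h1); first exact: Rhausdorff.
by apply: cvg_big => [|s _]; [exact: add_continuous|apply: cvgMr; exact: Q_cvg].
Qed.

(** * Invariant window and attained minimum *)

Definition rho := u * (1 - `|N|^-1).

Hypothesis Sbnd : {in S, forall s, `|s| <= u * (`|N| - 2)}.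

(** With [a = 0] this makes the window of radius [rho] invariant; for larger [a] it shrinks the
    excess over [rho], which drives the induction in [L_ge1]. *)
Lemma step_bnd x s a : s \in S -> `|x| <= rho + a ->
  `|(x + s) / N| <= rho + (a - u / `|N|) / `|N|.
Proof.
move=> /Sbnd hs hx; rewrite normrM normfV ler_pdivrMr //.
have -> : (rho + (a - u / `|N|) / `|N|) * `|N| = rho + a + u * (`|N| - 2).
  by rewrite /rho; field; rewrite gt_eqF.
by apply: le_trans (ler_normD _ _) _; apply: lerD.
Qed.

Let X := [set x : R | `|x| <= rho].

Lemma X_step x s : s \in S -> X x -> X ((x + s) / N).
Proof.
move=> sS; rewrite /X /= => hx; have := @step_bnd x s 0 sS.
rewrite addr0 sub0r => /(_ hx) /le_trans; apply.
by rewrite gerDl mulNr oppr_le0 !divr_ge0 // ltW.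
Qed.

Lemma rho_ge0 : 0 <= rho.
Proof. by rewrite /rho mulr_ge0 ?(ltW u0) // subr_ge0 invf_le1 // ltW. Qed.

Let c := inf (L @` X).

Lemma inf_le x : X x -> c <= L x.
Proof.
move=> hx; apply: ge_inf; last by exists x.
by exists 0 => _ [y _ <-]; apply: le_trans (Q_leL 0 y); exact: Q_ge0.
Qed.

(** As a supremum of continuous functions, [L] is lower semicontinuous, so a cluster point of a
    minimizing sequence in the compact window attains the infimum. *)
Lemma argmin : exists2 x, X x & L x <= c.
Proof.
have hinf : has_inf (L @` X).
  split; first by exists (L 0); exists 0 => //; rewrite /X /= normr0 rho_ge0.
  by exists 0 => _ [y _ <-]; apply: le_trans (Q_leL 0 y); exact: Q_ge0.
have /choice[a ha] : forall k : nat, exists x, X x /\ L x < c + k.+1%:R^-1.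
  move=> k; have k0 : 0 < k.+1%:R^-1 :> R by rewrite invr_gt0 ltr0n.
  have [_ [x hx <-] h] := @inf_adherent _ (L @` X) _ k0 hinf.
  by exists x.
have cX : compact X.
  have -> : X = `[(- rho), rho]%classic.
    by apply/seteqP; split => x; rewrite /X /= in_itv /= ler_norml.
  exact: segment_compact.
have [|p [Xp clp]] := cX (a @ \oo) _.
  by exists 0%N => // k _; have [] := ha k.
exists p => //; rewrite leNgt; apply/negP => cLp.
have [n hn] : exists n, c < Q n p.
  apply: contrapT => /forallNP h; move: cLp; apply/negP; rewrite -leNgt.
  by apply: L_leP => n; rewrite leNgt; apply/negP.
(* An intermediate value yields the contradiction: [Q n] stays above [c'] near [p], but is
   eventually below it along the minimizing sequence. *)
set c' := (c + Q n p) / 2.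
have hc' : c < c' < Q n p by rewrite /c'; lra.
have nb : nbhs p [set y | c' < Q n y].
  by apply: (cvgr_gt (Q n p) (@Q_cts n p)); case/andP: hc'.
have ev : (a @ \oo) [set y | Q n y < c'].
  have : \forall k \near \oo, k.+1%:R^-1 < c' - c.
    by apply: near_infty_natSinv_lt (PosNum _); lra.
  apply: filterS => k hk /=; apply: le_lt_trans (Q_leL _ _) _.
  by apply: lt_trans (ha k).2 _; rewrite -ltrBrDl.
have [y [h1 h2]] := clp _ _ ev nb.
by have := lt_trans h1 h2; rewrite ltxx.
Unshelve. all: by end_near.
Qed.

Let E := [set x | X x /\ L x <= c].

(** By [L_step], [L x] is a weighted mean of values at least [c]; if it is at most [c], every value
    of positive weight is at most [c] too. *)
Lemma E_step x s : s \in S -> E x -> M ((x + s) / N) != 0 -> E ((x + s) / N).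
Proof.
move=> sS [Xx Lx] Ms; split; first exact: X_step.
rewrite leNgt; apply/negP => cL.
suff : c < L x by rewrite ltNge Lx.
rewrite L_step -[c]mul1r -(Msum x) mulr_suml.
rewrite (bigD1_seq s) //= [ltRHS](bigD1_seq s) //=.
apply: ltr_leD; first by rewrite ltr_pM2l // lt_def Ms M_ge0.
by rewrite big_seq_cond [leRHS]big_seq_cond; apply: ler_sum => t /andP[tS _];
   rewrite ler_wpM2l //; apply: inf_le; apply: X_step.
Qed.

(** * The minimum is at least 1 *)

Hypothesis M_zeros : forall r : R, finite_set [set x : R | `|x| <= r /\ M x = 0].
Hypothesis M_peak : forall y : R, `|y| < u -> M y = 1 ->
  forall k : nat, M (y / N ^+ k) != 0.

Lemma inf_ge1_of0 : E 0 -> 1 <= c.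
Proof. by move=> [_]; apply: le_trans; rewrite -G0; exact: (Q_leL 0). Qed.

(** Division by [N] is the step of digit 0, which stays in [E] as long as [M] does not vanish at the
    point reached. *)
Lemma E_div x k : E x -> (forall j, (0 < j <= k)%N -> M (x / N ^+ j) != 0) ->
  E (x / N ^+ k).
Proof.
move=> Ex; elim: k => [|k IH] h; first by rewrite expr0 divr1.
have e : x / N ^+ k.+1 = (x / N ^+ k + 0) / N.
  by rewrite exprS addr0 invfM mulrA mulrAC.
rewrite e; apply: E_step => //.
  by apply: IH => j /andP[j0 jk]; apply: h; rewrite j0 ltnW.
by rewrite -e; apply: h; rewrite ltnSn.
Qed.

(** Lower semicontinuity passes the bound [L <= c] from small points of [E] to 0. *)
Lemma inf_ge1_small :
  (forall eps : R, 0 < eps -> exists2 x, E x & `|x| < eps) -> 1 <= c.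
Proof.
move=> h; apply: inf_ge1_of0; split; first by rewrite /X /= normr0 rho_ge0.
rewrite leNgt; apply/negP => c0.
have [n hn] : exists n, c < Q n 0.
  apply: contrapT => /forallNP h'; move: c0; apply/negP; rewrite -leNgt.
  by apply: L_leP => n; rewrite leNgt; apply/negP.
have : nbhs 0 [set y | c < Q n y].
  exact: (cvgr_gt (Q n 0) (@Q_cts n 0)).
case/nbhs_normP => e /= e0 he.
have [x [_ Lx] xe] := h _ e0.
have : c < Q n x by apply: he; rewrite /= sub0r normrN.
by rewrite ltNge (le_trans (Q_leL n x) Lx).
Qed.

Lemma expN_small (eps : R) : 0 < eps -> exists k, rho / `|N| ^+ k < eps.
Proof.
move=> e0; have [k hk] : exists k : nat, rho / eps < k%:R.
  exists (Num.bound (rho / eps)); apply: archi_boundP.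
  by rewrite divr_ge0 ?rho_ge0 ?ltW.
exists k; rewrite ltr_pdivrMr ?exprn_gt0 //.
rewrite mulrC -ltr_pdivrMr //; apply: lt_trans hk _.
apply: lt_le_trans (_ : 2 ^+ k <= _).
  by rewrite -natrX ltr_nat ltn_expl.
by apply: lerXn2r; rewrite // nnegrE.
Qed.

Lemma inf_ge1_infinite : infinite_set E -> 1 <= c.
Proof.
move=> infE; apply: inf_ge1_small => eps e0; have [k hk] := expN_small e0.
(* The points of the window from which the walk along the digit 0 may be blocked within [k] steps;
   they are finitely many, so an infinite [E] has a point outside. *)
pose Z := \bigcup_(j in `I_k.+1) [set x | X x /\ M (x / N ^+ j) = 0].
have fZ : finite_set Z.
  apply: bigcup_finite => // j _.
  have := M_zeros (rho / `|N| ^+ j).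
  move/(finite_image (fun x => x * N ^+ j)); apply: sub_finite_set.
  move=> x [Xx Mx]; exists (x / N ^+ j); last by rewrite divfK ?expf_neq0.
  by rewrite /= normrM normfV normrX ler_wpM2r // invr_ge0 exprn_ge0.
have [x [Ex nZ]] : exists x, E x /\ ~ Z x.
  apply: contrapT => /forallNP h; apply: infE.
  by apply: sub_finite_set fZ => x Ex; apply: contrapT => nz; exact: (h x).
exists (x / N ^+ k).
  apply: E_div => // j /andP[j0 jk]; apply/eqP => Mj; apply: nZ.
  by exists j => //; split => //; case: Ex.
apply: le_lt_trans hk; rewrite normrM normfV normrX ler_wpM2r ?invr_ge0 ?exprn_ge0 //.
by case: Ex.
Qed.

(** Since [rho < u], [M_peak] applies to [x], so its walk along the digit 0 is never blocked and
    tends to 0. *)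
Lemma inf_ge1_peak x : E x -> M x = 1 -> 1 <= c.
Proof.
move=> Ex Mx; apply: inf_ge1_small => eps e0; have [k hk] := expN_small e0.
exists (x / N ^+ k).
  apply: E_div => // j _; apply: M_peak => //.
  have [Xx _] := Ex; apply: le_lt_trans Xx _.
  by rewrite /rho gtr_pMr // ltrBlDr ltrDl invr_gt0.
apply: le_lt_trans hk; rewrite normrM normfV normrX ler_wpM2r ?invr_ge0 ?exprn_ge0 //.
by case: Ex.
Qed.

(* If M never takes the value 1 on E, every point of E has two successors in E,
   and distinct words lead to distinct points. *)
Lemma E_walks : (forall x, E x -> M x != 1) -> forall n x, E x ->
  exists W : seq (seq R), [/\ uniq W, (n < size W)%N,
    {subset W <= words S n} & {in W, forall w, E (walk N x w)}].
Proof.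
move=> hM; elim => [|n IH] x Ex.
  by exists [:: [::]]; split => // w; rewrite inE => /eqP ->.
have [s sS Ms] : exists2 s, s \in S & M ((x + s) / N) != 0.
  apply: contrapT => h; have := Msum x; rewrite big_seq big1 => [/eqP|s sS].
    by rewrite eq_sym oner_eq0.
  by apply/eqP; apply: contrapT => /negP hs; apply: h; exists s.
have Es := E_step sS Ex Ms.
(* Otherwise [(x + s) / N] would carry the whole weight 1, which [hM] forbids. *)
have [t tS [ts Mt]] : exists2 t, t \in S & t != s /\ M ((x + t) / N) != 0.
  apply: contrapT => h; have := hM _ Es; rewrite -(Msum x) (bigD1_seq s) //=.
  rewrite big_seq_cond big1 ?addr0 ?eqxx // => t /andP[tS ts].
  by apply/eqP; apply: contrapT => /negP ht; apply: h; exists t.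
have [W [uW sW WW WE]] := IH _ Es.
have [V [uV sV VW VE]] := IH _ (E_step tS Ex Mt).
exists ([seq s :: w | w <- W] ++ [seq t :: w | w <- V]); split.
- rewrite cat_uniq !map_inj_uniq ?uW ?uV //=; try by move=> ? ? [].
  rewrite andbT; apply/hasPn => _ /mapP[v _ ->]; apply/negP => /mapP[w _ [e _]].
  by rewrite e eqxx in ts.
- by rewrite size_cat !size_map -addn1 leq_add // (leq_ltn_trans _ sV).
- move=> w; rewrite mem_cat => /orP[] /mapP[v hv ->]; apply: allpairs_f => //.
    exact: WW.
  exact: VW.
- move=> w; rewrite mem_cat => /orP[] /mapP[v hv ->] /=.
    exact: WE.
  exact: VE.
Qed.

Lemma inf_ge1 : 1 <= c.
Proof.
have [x Xx Lx] := argmin; have Ex : E x by [].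
have [[y Ey My]|h] := pselect (exists2 y, E y & M y = 1).
  exact: inf_ge1_peak Ey My.
apply: inf_ge1_infinite => -/finite_fsetP[F EF].
have hM y : E y -> M y != 1 by move=> Ey; apply/eqP => My; apply: h; exists y.
(* The cardinality of [F] serves as word length: it yields more words than [F] has points, while
   words of equal length reach distinct points. *)
have [W [uW sW WW WE]] := E_walks hM #|` F| Ex.
have sub : {subset [seq walk N x w | w <- W] <= enum_fset F}.
  move=> _ /mapP[w hw ->]; have : E (walk N x w) by exact: WE.
  by rewrite EF.
have : uniq [seq walk N x w | w <- W].
  rewrite map_inj_in_uniq // => w v /WW + /WW; rewrite !mem_words.
  move=> /andP[/eqP sw wS] /andP[/eqP sv vS]; rewrite !walkE // sw sv.
  have NN : N ^+ #|` F| != 0 by rewrite expf_neq0.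
  move=> /(mulIf (invr_neq0 NN)) /addrI; apply: lam_inj => //.
  by rewrite sw sv.
move=> /uniq_leq_size /(_ sub); rewrite size_map => hle.
by have := leq_ltn_trans hle sW; rewrite ltnn.
Qed.

(** Induction on the number of units [u / |N|] by which [|x|] may exceed [rho]: all successors of
    [x] have one unit less, and their weights add up to 1. *)
Lemma L_ge1 x : 1 <= L x.
Proof.
have [k] : exists k : nat, `|x| <= rho + k%:R * (u / `|N|).
  have uN : 0 < u / `|N| by rewrite divr_gt0.
  exists (Num.bound (`|x| / (u / `|N|))).
  rewrite ler_wpDl ?rho_ge0 // -ler_pdivrMr //.
  by apply: ltW; apply: archi_boundP; rewrite divr_ge0 // ltW.
elim: k x => [|k IH] x.
  by rewrite mul0r addr0 => Xx; apply: le_trans inf_ge1 _; exact: inf_le.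
move=> hx; rewrite L_step -[leLHS](Msum x).
rewrite big_seq [leRHS]big_seq; apply: ler_sum => s sS.
rewrite ler_peMr //; apply: IH; apply: le_trans (step_bnd sS hx) _.
have -> : k.+1%:R * (u / `|N|) - u / `|N| = k%:R * (u / `|N|).
  by rewrite -natr1; ring.
rewrite lerD2l.
rewrite ler_pdivrMr // ler_peMr //; last exact: ltW.
by rewrite mulr_ge0 // divr_ge0 // ltW.
Qed.

Lemma transfer_total x eps : 0 < eps ->
  exists n, 1 - eps < \sum_(w <- words S n) G (x + lam N w).
Proof.
move=> e0; apply: contrapT => /forallNP h.
have : L x <= 1 - eps.
  by apply: L_leP => n; rewrite QE leNgt; apply/negP; exact: h.
by apply/negP; rewrite -ltNge; have := L_ge1 x; lra.
Qed.

End transfer.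

(** * Exponentials and the symbol of D *)

Section cis.
Variable R : realType.
Implicit Types (z w : R[i]) (t : R).

(** The squared modulus with values in [R], polynomial in both parts; it avoids square roots and the
    complex-valued norm. *)
Definition sqn (z : R[i]) : R := complex.Re z ^+ 2 + complex.Im z ^+ 2.

Lemma sqn_ge0 z : 0 <= sqn z.
Proof. by rewrite /sqn addr_ge0 ?sqr_ge0. Qed.

Lemma sqnM z w : sqn (z * w) = sqn z * sqn w.
Proof. by case: z => a b; case: w => c d; rewrite /sqn /=; ring. Qed.

Lemma sqn0 : sqn 0 = 0.
Proof. by rewrite /sqn /=; ring. Qed.

Lemma sqn1 : sqn 1 = 1.
Proof. by rewrite /sqn /=; ring. Qed.

Lemma sqn_eq0 z : (sqn z == 0) = (z == 0).
Proof.
case: z => a b; rewrite /sqn /= paddr_eq0 ?sqr_ge0 // !sqrf_eq0.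
by rewrite eq_complex.
Qed.

Lemma sqnC (a : R) : sqn a%:C%C = a ^+ 2.
Proof. by rewrite /sqn /=; ring. Qed.

Lemma sqn_conj z : sqn (conjc z) = sqn z.
Proof. by case: z => a b; rewrite /sqn /= sqrrN. Qed.

Lemma sqnE z : (sqn z)%:C%C = z * conjc z.
Proof. by case: z => a b; apply/eqP; rewrite eq_complex /sqn /=; apply/andP; split; apply/eqP; ring. Qed.

Lemma sqn_Re z : sqn z = complex.Re (z * conjc z).
Proof. by rewrite -sqnE. Qed.

Lemma normc_sqr z : Normc.normc z ^+ 2 = sqn z.
Proof. by case: z => a b; rewrite /Normc.normc sqr_sqrtr // addr_ge0 ?sqr_ge0. Qed.

Lemma sqnD_le z w : sqn (z + w) <= 2 * sqn z + 2 * sqn w.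
Proof.
case: z => a b; case: w => c d; rewrite /sqn /=.
have := sqr_ge0 (a - c); have := sqr_ge0 (b - d); nra.
Qed.

Lemma ReD z w : complex.Re (z + w) = complex.Re z + complex.Re w.
Proof. by case: z; case: w. Qed.

Lemma ImD z w : complex.Im (z + w) = complex.Im z + complex.Im w.
Proof. by case: z; case: w. Qed.

Lemma Re_sum (I : Type) (r : seq I) (F : I -> R[i]) :
  complex.Re (\sum_(i <- r) F i) = \sum_(i <- r) complex.Re (F i).
Proof. by rewrite (big_morph (@complex.Re R) ReD (erefl : complex.Re (0 : R[i]) = 0)). Qed.

Lemma Im_sum (I : Type) (r : seq I) (F : I -> R[i]) :
  complex.Im (\sum_(i <- r) F i) = \sum_(i <- r) complex.Im (F i).
Proof. by rewrite (big_morph (@complex.Im R) ImD (erefl : complex.Im (0 : R[i]) = 0)). Qed.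

Lemma cis2piD (s t : R) : cis2pi (s + t) = cis2pi s * cis2pi t.
Proof.
by rewrite /cis2pi mulrDr cosD sinD; apply/eqP; rewrite eq_complex /=;
   apply/andP; split; apply/eqP; ring.
Qed.

Lemma cis2pi0 : cis2pi (0 : R) = 1.
Proof. by rewrite /cis2pi mulr0 cos0 sin0. Qed.

Lemma cis2piN (t : R) : cis2pi (- t) = conjc (cis2pi t).
Proof. by rewrite /cis2pi mulrN cosN sinN. Qed.

Lemma sqn_cis (t : R) : sqn (cis2pi t) = 1.
Proof. by rewrite /sqn /= cos2Dsin2. Qed.

Lemma cis2pi_conjM (t : R) : cis2pi t * conjc (cis2pi t) = 1.
Proof. by rewrite -cis2piN -cis2piD subrr cis2pi0. Qed.

Lemma cis2piX (t : R) n : cis2pi (t *+ n) = cis2pi t ^+ n.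
Proof.
by elim: n => [|n IH]; rewrite ?mulr0n ?cis2pi0 // mulrS exprS cis2piD IH.
Qed.

Lemma cis2pi_nat n : cis2pi (n%:R : R) = 1.
Proof.
rewrite cis2piX (_ : cis2pi 1 = 1) ?expr1n // /cis2pi mulr1.
by rewrite mulr_natl cos2pi sin2pi.
Qed.

Lemma cis2pi_int (t : R) : t \is a Num.int -> cis2pi t = 1.
Proof.
move=> /intrP[[n|n] ->]; first exact: cis2pi_nat.
by rewrite NegzE mulrNz cis2piN cis2pi_nat conjc1.
Qed.

(** For the fractional part [f], the real part is 1 - 2 sin^2(pi f), so sin(pi f) = 0; the sine is
    positive strictly between 0 and pi, which leaves [f = 0]. *)
Lemma cis2pi_Re1 (t : R) : complex.Re (cis2pi t) = 1 -> t \is a Num.int.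
Proof.
move=> h; rewrite -[t](subrK (Num.floor t)%:~R) rpredD ?intr_int //; set f := t - _.
have f01 : 0 <= f < 1.
  by rewrite /f subr_ge0 ltrBlDr addrC -intrD1 floor_le lt_succ_floor.
have : complex.Re (cis2pi f) = 1.
  by rewrite /f cis2piD -mulrNz (@cis2pi_int (_%:~R)) ?mulr1 ?intr_int.
rewrite /= -mulrA mulr_natl cos_mulr2n => h2.
have : sin (pi * f) ^+ 2 = 0.
  by have := cos2Dsin2 (pi * f); move: h2; set c := cos _ ^+ 2; lra.
move/eqP; rewrite sqrf_eq0 => /eqP s0.
case/andP: f01; rewrite le_eqVlt => /orP[/eqP <- _|f0 f1]; first exact: rpred0.
have : 0 < sin (pi * f).
  by apply: sin_gt0_pi; rewrite mulr_gt0 ?pi_gt0 // gtr_pMr ?pi_gt0.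
by rewrite s0 ltxx.
Qed.

End cis.

(** * The symbol of the digit set and its squared modulus *)

Section mask.
Variables (R : realType) (D : seq int).

Definition mask (t : R) : R[i] :=
  ((size D)%:R^-1)%:C%C * \sum_(d <- D) cis2pi (d%:~R * t).

(** When [D] is a singleton this is all of [R]. *)
Definition dual_lattice : set R :=
  [set p | forall d d', d \in D -> d' \in D -> (d - d')%:~R * p \is a Num.int].

Definition mask2 (t : R) : R := sqn (mask t).

Lemma mask2_ge0 t : 0 <= mask2 t. Proof. exact: sqn_ge0. Qed.

Lemma mask2E t : mask2 t = (size D)%:R^-1 ^+ 2 *
  \sum_(d <- D) \sum_(d' <- D) complex.Re (cis2pi ((d - d')%:~R * t)).
Proof.
rewrite /mask2 /mask sqnM sqnC; congr (_ * _).
rewrite sqn_Re raddf_sum mulr_suml Re_sum; apply: eq_bigr => d _.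
rewrite mulr_sumr Re_sum; apply: eq_bigr => d' _.
by rewrite intrB mulrBl cis2piD cis2piN.
Qed.

Lemma mask2_period t p : dual_lattice p -> mask2 (t + p) = mask2 t.
Proof.
move=> Pp; rewrite !mask2E; congr (_ * _).
rewrite big_seq [RHS]big_seq; apply: eq_bigr => d dD.
rewrite big_seq [RHS]big_seq; apply: eq_bigr => d' dD'.
by rewrite mulrDr cis2piD [X in _ * X]cis2pi_int ?mulr1 //; exact: Pp.
Qed.

Lemma mask2_0 : D != [::] -> mask2 0 = 1.
Proof.
move=> D0; rewrite /mask2 /mask (eq_bigr (fun=> 1)) => [|d _]; last first.
  by rewrite mulr0 cis2pi0.
rewrite big_const_seq count_predT iter_addr_0.
have -> : 1 *+ size D = ((size D)%:R)%:C%C :> R[i] by rewrite rmorph_nat.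
rewrite -rmorphM mulVf ?sqn1 //.
by rewrite pnatr_eq0 size_eq0.
Qed.

Lemma mask2_cts : continuous mask2.
Proof.
have hc d d' : continuous (fun t : R => complex.Re (cis2pi ((d - d')%:~R * t))).
  move=> t /=; apply: continuous_comp; last exact: continuous_cos.
  by apply: cvgM; [exact: cvg_cst|apply: cvgM; [exact: cvg_cst|exact: cvg_id]].
move=> t; rewrite /continuous_at mask2E.
have -> : mask2 = (fun t => (size D)%:R^-1 ^+ 2 *
  \sum_(d <- D) \sum_(d' <- D) complex.Re (cis2pi ((d - d')%:~R * t))).
  by apply/funext => s; rewrite mask2E.
apply: cvgMr; apply: cvg_big => [|d _]; first exact: add_continuous.
apply: cvg_big => [|d' _]; first exact: add_continuous.
exact: hc.
Qed.

(* |m(t)| = 1 forces equality in the triangle inequality. *)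
Lemma mask2_peak t : D != [::] -> mask2 t = 1 -> dual_lattice t.
Proof.
move=> D0; set q : R := (size D)%:R.
have q0 : q != 0 by rewrite pnatr_eq0 size_eq0.
rewrite mask2E => /(congr1 (fun z => q ^+ 2 * z)).
rewrite mulrA -exprMn mulfV // expr1n mul1r mulr1 => h.
have h0 : \sum_(d <- D) \sum_(d' <- D)
    (1 - complex.Re (cis2pi ((d - d')%:~R * t))) = 0.
  under eq_bigr do rewrite sumrB.
  rewrite sumrB h !big_const_seq !count_predT !iter_addr_0.
  by rewrite -mulrnA natrM expr2 subrr.
have g0 d d' : 0 <= 1 - complex.Re (cis2pi ((d - d')%:~R * t)).
  by rewrite subr_ge0 cos_le1.
move=> d d' dD dD'; apply: cis2pi_Re1; apply/eqP.
move/eqP: h0; rewrite psumr_eq0 => [/allP /(_ _ dD)|]; last first.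
  by move=> i _; apply: sumr_ge0.
by rewrite psumr_eq0 // => /allP /(_ _ dD'); rewrite /= subr_eq0 eq_sym.
Qed.

(** Up to nonzero factors the symbol is a polynomial in e(t), with finitely many roots; a bounded
    [t] is recovered from e(t) and one of finitely many integer parts. *)
Lemma mask2_zeros (r : R) : D != [::] ->
  finite_set [set t : R | `|t| <= r /\ mask2 t = 0].
Proof.
(* [K] dominates every [|d|], so multiplication by e(K t) makes all exponents nonnegative. *)
move=> D0; pose K : nat := (\sum_(d <- D) `|d|)%N.
have Kd d : d \in D -> 0 <= K%:Z + d.
  move=> dD; have : (`|d| <= K)%N.
    by rewrite /K (big_rem d) //= leq_addr.
  lia.
pose p : {poly R[i]} := \sum_(d <- D) 'X^(absz (K%:Z + d)).
have pE t : p.[cis2pi t] = cis2pi (K%:R * t) * \sum_(d <- D) cis2pi (d%:~R * t).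
  rewrite /p horner_sum mulr_sumr big_seq [RHS]big_seq; apply: eq_bigr => d dD.
  rewrite hornerXn -cis2piX -cis2piD -mulrDl -[t *+ _]mulr_natl.
  by rewrite [K%:R]pmulrn -intrD [X in X * t]pmulrn gez0_abs ?Kd.
have p0 : p != 0.
  (* At [t = 0] the polynomial takes the number of digits as its value. *)
  apply/eqP => p0; have := pE 0; rewrite p0 horner0 mulr0 cis2pi0 mul1r.
  rewrite (eq_bigr (fun=> 1)) => [|d _]; last by rewrite mulr0 cis2pi0.
  rewrite big_const_seq count_predT iter_addr_0 => /eqP.
  by rewrite eq_sym pnatr_eq0 size_eq0 (negbTE D0).
have [rs prs] := closed_field_poly_normal p.
pose g (t : R) := (cis2pi t, Num.floor t).
have ginj : injective g.
  move=> s t [] cE sE fE.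
  have : s - t \is a Num.int.
    apply: cis2pi_Re1; rewrite cis2piD cis2piN.
    have -> : cis2pi s = cis2pi t by rewrite /cis2pi cE sE.
    by rewrite cis2pi_conjM.
  move=> /intrP[k hk].
  have h1 := floor_le s; have h2 := lt_succ_floor s.
  have h3 := floor_le t; have h4 := lt_succ_floor t.
  rewrite -fE in h3 h4.
  have : `|k%:~R : R| < 1.
    rewrite -hk ltr_norml; rewrite intrD1 in h2 h4.
    by apply/andP; split; lra.
  rewrite -intr_norm -[1]/(1%:~R) ltr_int => k1.
  have k0 : k = 0 by lia.
  by apply/eqP; rewrite -subr_eq0 hk k0.
pose B := (Num.bound r).+1.
(* The integers from [-B] to [B - 1], which include the floor of every [t] with [|t| <= r]. *)
pose ks : seq int := [seq n%:Z - B%:Z | n <- iota 0 (B + B)].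
apply: (@sub_finite_set _ _ (g @^-1` ([set` rs] `*` [set` ks]))); last first.
  apply: finite_preimage; first by move=> s t _ _; exact: ginj.
  by apply: finite_setX; exact: finite_seq.
move=> t [tr mt0]; split => /=.
  have : root p (cis2pi t).
    apply/rootP; rewrite pE; apply/eqP; rewrite mulf_eq0; apply/orP; right.
    move/eqP: mt0; rewrite sqn_eq0 mulf_eq0 => /orP[|//].
    by rewrite fmorph_eq0 invr_eq0 pnatr_eq0 size_eq0 (negbTE D0).
  rewrite prs rootZ ?lead_coef_eq0 // root_prod_XsubC //.
have tB : `|t| < (B.-1)%:R.
  have r0 : 0 <= r := le_trans (normr_ge0 t) tr.
  by apply: le_lt_trans tr _; exact: archi_boundP.
move: tB; rewrite ltr_norml => /andP[h1 h2].
have h3 := floor_le t; have h4 := lt_succ_floor t.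
have k1 : (Num.floor t < B.-1%:Z).
  by rewrite -(@ltr_int R); apply: le_lt_trans h3 _.
have k2 : (- B.-1%:Z < Num.floor t + 1).
  by rewrite -(@ltr_int R) mulrNz; apply: lt_trans h1 h4.
apply/mapP; exists (absz (Num.floor t + B%:Z)); last by lia.
by rewrite mem_iota; lia.
Qed.

End mask.

(** * Fourier transform of a self-similar measure *)

Section fourier.
Variables (R : realType) (mu : probability (measurableTypeR R) R).
Local Notation T := (measurableTypeR R).

Lemma bounded_integrable (f : T -> R) (K : R) :
  measurable_fun setT f -> (forall x, `|f x| <= K) ->
  mu.-integrable setT (EFin \o f).
Proof.
move=> mf fK; apply: measurable_bounded_integrable => //.
  by apply: le_lt_trans (probability_le1 mu measurableT) (ltry _).
exists K; split; first exact: num_real.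
by move=> L KL x _; apply: le_trans (fK x) (ltW KL).
Qed.

Lemma continuous_cos_mul (t : R) : continuous (fun x : R => cos (2 * pi * (t * x))).
Proof.
move=> x; apply: continuous_comp; last exact: continuous_cos.
by apply: cvgM; [exact: cvg_cst|apply: cvgM; [exact: cvg_cst|exact: cvg_id]].
Qed.

Lemma continuous_sin_mul (t : R) : continuous (fun x : R => sin (2 * pi * (t * x))).
Proof.
move=> x; apply: continuous_comp; last exact: continuous_sin.
by apply: cvgM; [exact: cvg_cst|apply: cvgM; [exact: cvg_cst|exact: cvg_id]].
Qed.

Lemma measurable_cis_Re (t : R) :
  measurable_fun [set: T] (fun x : T => complex.Re (cis2pi (t * x))).
Proof. exact: (continuous_measurable_fun (@continuous_cos_mul t)). Qed.

Lemma measurable_cis_Im (t : R) :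
  measurable_fun [set: T] (fun x : T => complex.Im (cis2pi (t * x))).
Proof. exact: (continuous_measurable_fun (@continuous_sin_mul t)). Qed.

Lemma integrable_cis_Re (t : R) :
  mu.-integrable [set: T] (EFin \o (fun x : T => complex.Re (cis2pi (t * x)))).
Proof.
apply: (@bounded_integrable _ 1); first exact: measurable_cis_Re.
by move=> x; rewrite ler_norml cos_geN1 cos_le1.
Qed.

Lemma integrable_cis_Im (t : R) :
  mu.-integrable [set: T] (EFin \o (fun x : T => complex.Im (cis2pi (t * x)))).
Proof.
apply: (@bounded_integrable _ 1); first exact: measurable_cis_Im.
by move=> x; rewrite ler_norml sin_geN1 sin_le1.
Qed.

Lemma Rintegral_cstT (c : R) : \int[mu]_x c = c.
Proof.
transitivity (c * fine (mu setT)); first exact: Rintegral_cst.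
by rewrite -[RHS]mulr1; congr *%R; rewrite [mu _](probability_setT mu).
Qed.

Definition ft (t : R) : R[i] :=
  Complex (\int[mu]_x complex.Re (cis2pi (t * x)))
    (\int[mu]_x complex.Im (cis2pi (t * x))).

Lemma ft0 : ft 0 = 1.
Proof.
rewrite /ft; apply/eqP; rewrite eq_complex /=; apply/andP; split; apply/eqP.
  rewrite -[RHS]Rintegral_cstT; apply: eq_Rintegral => x _.
  by rewrite mul0r mulr0 cos0.
rewrite -[RHS]Rintegral_cstT; apply: eq_Rintegral => x _.
by rewrite mul0r mulr0 sin0.
Qed.

Lemma ftN t : ft (- t) = conjc (ft t).
Proof.
rewrite /ft; apply/eqP; rewrite eq_complex /=; apply/andP; split; apply/eqP.
  by apply: eq_Rintegral => x _; rewrite mulNr mulrN cosN.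
rewrite -[RHS]mulN1r -RintegralZl //; last exact: integrable_cis_Im.
by apply: eq_Rintegral => x _; rewrite /= mulNr mulrN sinN mulN1r.
Qed.

(** Continuity under the integral sign, with the constant 1 as majorant for both cosine and sine. *)
Lemma ft_continuous : continuous (fun t => sqn (ft t)).
Proof.
have key (h : R -> R) : continuous h -> (forall x, `|h x| <= 1) ->
    continuous (fun t : R => \int[mu]_x h (2 * pi * (t * x))).
  move=> ch h1 t.
  have mh s : measurable_fun [set: T] (fun x : T => h (2 * pi * (s * x))).
    apply: continuous_measurable_fun => x.
    apply: continuous_comp; last exact: ch.
    by apply: cvgM; [exact: cvg_cst|apply: cvgM; [exact: cvg_cst|exact: cvg_id]].
  apply: (@continuity_under_integral R _ T mu (fun s x => h (2 * pi * (s * x)))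
    setT measurableT (t - 1) (t + 1) _ _ (cst 1)).
  - by move=> s _; apply: (@bounded_integrable _ 1).
  - apply: aeW => x _ s _; apply: continuous_comp; last exact: ch.
    by apply: cvgM; [exact: cvg_cst|apply: cvgM; [exact: cvg_id|exact: cvg_cst]].
  - by apply: (@bounded_integrable _ 1) => // x; rewrite normr1.
  - by move=> s _; apply: aeW => x _.
  - by rewrite inE /= in_itv /=; lra.
have cb x : `|cos x : R| <= 1 by rewrite ler_norml cos_geN1 cos_le1.
have sb x : `|sin x : R| <= 1 by rewrite ler_norml sin_geN1 sin_le1.
have kc := key _ (@continuous_cos R) cb.
have ks := key _ (@continuous_sin R) sb.
move=> t; rewrite /sqn /=; apply: cvgD; rewrite /=.
  by apply: cvgM; exact: kc.
by apply: cvgM; exact: ks.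
Qed.

Lemma Rintegral_sum (I : Type) (r : seq I) (F : I -> T -> R) :
  (forall i, mu.-integrable setT (EFin \o F i)) ->
  \int[mu]_x (\sum_(i <- r) F i x) = \sum_(i <- r) \int[mu]_x F i x.
Proof.
move=> iF; elim: r => [|i r IH].
  rewrite big_nil -[RHS]Rintegral_cstT.
  by apply: eq_Rintegral => x _; rewrite big_nil.
rewrite big_cons -IH -RintegralD //; first by apply: eq_Rintegral => x _; rewrite big_cons.
have -> : EFin \o (fun x => \sum_(j <- r) F j x) =
    (fun x => (\sum_(j <- r) (EFin \o F j) x)%E).
  by apply/funext => x /=; rewrite sumEFin.
by apply: integrable_sum.
Qed.

Lemma integral_Re_trig (I : Type) (r : seq I) (a : I -> R[i]) (t : I -> R) :
  \int[mu]_x complex.Re (\sum_(i <- r) a i * cis2pi (t i * x)) =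
  complex.Re (\sum_(i <- r) a i * ft (t i)).
Proof.
under eq_Rintegral do rewrite Re_sum.
have ReM (z w : R[i]) : complex.Re (z * w) =
  complex.Re z * complex.Re w - complex.Im z * complex.Im w by case: z; case: w.
have iR i : mu.-integrable setT
    (EFin \o (fun x => complex.Re (a i) * complex.Re (cis2pi (t i * x)))).
  have := integrableZl measurableT (complex.Re (a i)) (integrable_cis_Re (t i)).
  by apply: eq_integrable => // x _; rewrite /= EFinM.
have iI i : mu.-integrable setT
    (EFin \o (fun x => complex.Im (a i) * complex.Im (cis2pi (t i * x)))).
  have := integrableZl measurableT (complex.Im (a i)) (integrable_cis_Im (t i)).
  by apply: eq_integrable => // x _; rewrite /= EFinM.
rewrite Rintegral_sum => [|i].
  rewrite Re_sum; apply: eq_bigr => i _; rewrite ReM.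
  under eq_Rintegral do rewrite ReM.
  rewrite RintegralB //.
  by rewrite !RintegralZl //; [exact: integrable_cis_Im|exact: integrable_cis_Re].
have := integrableB measurableT (iR i) (iI i).
by apply: eq_integrable => // x _; rewrite /= ReM EFinB.
Qed.

Lemma L2dot_cis (s t : R) :
  L2dot mu (fun x => cis2pi (s * x)) (fun x => cis2pi (t * x)) = ft (s - t).
Proof.
by rewrite /L2dot /ft; congr Complex; apply: eq_Rintegral => x _;
   rewrite -cis2piN -cis2piD mulrBl.
Qed.

End fourier.

(** * The functional equation of the Fourier transform *)

Section self_similar.
Variables (R : realType) (N : int) (D : {fset int}).
Variable mu : probability (measurableTypeR R) R.
Local Notation T := (measurableTypeR R).
Hypothesis hmu : is_self_similar N D mu.
Hypothesis D0 : (0 < #|` D|)%N.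

Lemma measurable_phi (d : int) : measurable_fun [set: T] (@phi R N d).
Proof.
apply: (continuous_measurable_fun (f := @phi R N d)) => x.
by apply: cvgM; [exact: cvg_cst|apply: cvgD; [exact: cvg_id|exact: cvg_cst]].
Qed.

Lemma ge0_integral_self_similar (f : T -> R) : measurable_fun setT f ->
  (forall x, 0 <= f x) ->
  (\int[mu]_x (f x)%:E =
   \sum_(d <- D) (#|` D|%:R^-1)%:E * \int[mu]_x (f (phi N d x))%:E)%E.
Proof.
move=> mf f0.
have q0 : 0 <= (#|` D|%:R^-1 : R) by rewrite invr_ge0.
pose k : {nonneg R} := NngNum q0.
(* [msum] takes a sequence of measures, so the digits are enumerated; the default 0 lies beyond the
   summed range. *)
pose m' (n : nat) : {measure set T -> \bar R} :=
  mscale k (pushforward mu (phi N (nth 0 (enum_fset D) n))).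
pose m_ := m' (fun n => @measurable_phi _).
have mE : measurable_fun setT (EFin \o f) by exact/measurable_EFinP.
rewrite (eq_measure_integral (msum m_ #|` D|)) => [|A mA _]; last first.
  apply: (etrans (hmu mA)); rewrite /msum /= (big_nth 0) big_mkord.
  by apply: eq_bigr => i _.
rewrite ge0_integral_measure_sum //; last by move=> x _; rewrite lee_fin.
rewrite [RHS](big_nth 0) big_mkord; apply: eq_bigr => i _.
rewrite ge0_integral_mscale //; last by move=> x _; rewrite lee_fin.
congr (_ * _)%E; rewrite ge0_integral_pushforward //.
- exact: measurable_phi.
- by move=> x _; rewrite lee_fin.
Qed.

(** The nonnegative case is applied to [1 + f]; the constant cancels because the weights add up to
    1. *)
Lemma Rintegral_self_similar (f : T -> R) : measurable_fun setT f ->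
  (forall x, `|f x| <= 1) ->
  \int[mu]_x f x = #|` D|%:R^-1 * \sum_(d <- D) \int[mu]_x f (phi N d x).
Proof.
move=> mf f1.
have q0 : #|` D|%:R != 0 :> R by rewrite pnatr_eq0 -lt0n.
have mfp d : measurable_fun setT (f \o @phi R N d).
  exact: measurableT_comp mf (measurable_phi d).
have shift (g : T -> R) : measurable_fun setT g -> (forall x, `|g x| <= 1) ->
    (\int[mu]_x (1 + g x)%:E = (1 + \int[mu]_x g x)%:E)%E.
  move=> mg g1.
  have i1 : mu.-integrable setT (EFin \o (cst 1 : T -> R)).
    by apply: (@bounded_integrable _ _ _ 1) => // x; rewrite normr1.
  have ig : mu.-integrable setT (EFin \o g) by exact: bounded_integrable mg g1.
  have e : \int[mu]_x (1 + g x) = 1 + \int[mu]_x g x.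
    rewrite (@RintegralD _ _ _ mu setT (cst 1) g) //.
    by rewrite (Rintegral_cstT mu 1).
  rewrite -e /Rintegral fineK //; apply: integrable_fin_num => //.
  have := integrableD measurableT i1 ig.
  by apply: eq_integrable => // x _.
have := @ge0_integral_self_similar (fun x => 1 + f x)
  (measurable_funD (measurable_cst (1 : R)) mf).
have hs d : (\int[mu]_x (1 + f (phi N d x))%:E =
    (1 + \int[mu]_x f (phi N d x))%:E)%E.
  by apply: (shift (f \o phi N d)) => // x; exact: f1.
rewrite (shift f) //; under eq_bigr => d _ do rewrite hs -EFinM.
rewrite sumEFin => h; have {}h : 1 + \int[mu]_x f x =
    \sum_(d <- D) #|` D|%:R^-1 * (1 + \int[mu]_x f (phi N d x)).
  apply: EFin_inj; apply: h => x.
  by have := f1 x; rewrite ler_norml; lra.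
apply: (addrI 1); rewrite h -mulr_sumr big_split /= mulrDr; congr (_ + _).
by rewrite big_const_seq count_predT iter_addr_0 mulVf.
Qed.

Hypothesis N0 : N != 0.

Lemma ft_self_similar (t : R) :
  ft mu t = mask (enum_fset D) (t / N%:~R) * ft mu (t / N%:~R).
Proof.
have N0' : N%:~R != 0 :> R by rewrite intr_eq0.
(* The phase splits into a constant depending on [d] and the phase at frequency [t / N]; the
   addition formulas then factor out the symbol. *)
have e d (x : T) : t * phi N d x = d%:~R * (t / N%:~R) + t / N%:~R * x.
  by rewrite /phi; field.
have ReM (z w : R[i]) : complex.Re (z * w) =
  complex.Re z * complex.Re w - complex.Im z * complex.Im w by case: z; case: w.
have ImM (z w : R[i]) : complex.Im (z * w) =
  complex.Re z * complex.Im w + complex.Im z * complex.Re w by case: z; case: w.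
have iR s c : mu.-integrable setT
    (EFin \o (fun x : T => c * complex.Re (cis2pi (s * x)))).
  have := integrableZl measurableT c (integrable_cis_Re mu s).
  by apply: eq_integrable => // x _; rewrite /= EFinM.
have iI s c : mu.-integrable setT
    (EFin \o (fun x : T => c * complex.Im (cis2pi (s * x)))).
  have := integrableZl measurableT c (integrable_cis_Im mu s).
  by apply: eq_integrable => // x _; rewrite /= EFinM.
rewrite /mask -mulrA mulr_suml.
apply/eqP; rewrite eq_complex; apply/andP; split; apply/eqP.
  rewrite /= Rintegral_self_similar; last 2 first.
  - exact: (@measurable_cis_Re _ t).
  - by move=> x; rewrite ler_norml cos_geN1 cos_le1.
  rewrite ReM [complex.Re _%:C%C]/= [complex.Im _%:C%C]/= mul0r subr0 Re_sum; congr (_ * _); apply: eq_bigr => d _.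
  rewrite ReM /ft /= -!RintegralZl //; last 2 first.
  - exact: integrable_cis_Im.
  - exact: integrable_cis_Re.
  rewrite -RintegralB //; [|exact: iR|exact: iI].
  by apply: eq_Rintegral => x _; rewrite e mulrDr cosD.
rewrite /= Rintegral_self_similar; last 2 first.
- exact: (@measurable_cis_Im _ t).
- by move=> x; rewrite ler_norml sin_geN1 sin_le1.
rewrite ImM [complex.Re _%:C%C]/= [complex.Im _%:C%C]/= mul0r addr0 Im_sum; congr (_ * _); apply: eq_bigr => d _.
rewrite ImM /ft /= -!RintegralZl //; last 2 first.
- exact: integrable_cis_Re.
- exact: integrable_cis_Im.
rewrite -RintegralD //; [|exact: iI|exact: iR].
by apply: eq_Rintegral => x _; rewrite e mulrDr sinD addrC.
Qed.

End self_similar.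

(** * Density of trigonometric polynomials *)

Section trig_polynomials.
Variable R : realType.

(** Pairs of coefficient and frequency, in which frequencies may repeat, so that sums and products
    are list operations; [is_spectrum_total] regroups them. *)
Definition trig (p : seq (R[i] * R)) (x : R) : R[i] :=
  \sum_(a <- p) a.1 * cis2pi (a.2 * x).

Lemma trig_cat p q x : trig (p ++ q) x = trig p x + trig q x.
Proof. by rewrite /trig big_cat. Qed.

Lemma trig_scale c p x : trig [seq (c * a.1, a.2) | a <- p] x = c * trig p x.
Proof.
by rewrite /trig big_map mulr_sumr; apply: eq_bigr => a _; rewrite mulrA.
Qed.

Lemma trig_mul p q x :
  trig [seq (a.1 * b.1, a.2 + b.2) | a <- p, b <- q] x = trig p x * trig q x.
Proof.
rewrite /trig big_allpairs_dep mulr_suml; apply: eq_bigr => a _.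
rewrite mulr_sumr; apply: eq_bigr => b _ /=.
by rewrite mulrDl cis2piD; ring.
Qed.

Definition is_trig (h : R -> R) := exists p, forall x, (h x)%:C%C = trig p x.

Lemma is_trig_cst c : is_trig (fun=> c).
Proof.
by exists [:: (c%:C%C, 0)] => x; rewrite /trig big_seq1 /= mul0r cis2pi0 mulr1.
Qed.

Lemma is_trigD g h : is_trig g -> is_trig h -> is_trig (fun x => g x + h x).
Proof.
move=> [p pE] [q qE]; exists (p ++ q) => x.
by rewrite trig_cat -pE -qE rmorphD.
Qed.

Lemma is_trigM g h : is_trig g -> is_trig h -> is_trig (fun x => g x * h x).
Proof.
move=> [p pE] [q qE].
exists [seq (a.1 * b.1, a.2 + b.2) | a <- p, b <- q] => x.
by rewrite trig_mul -pE -qE rmorphM.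
Qed.

Lemma is_trigB g h : is_trig g -> is_trig h -> is_trig (fun x => g x - h x).
Proof.
move=> tg th; have := is_trigD tg (is_trigM (is_trig_cst (- 1)) th).
by under eq_fun do rewrite mulN1r.
Qed.

Lemma is_trigX g n : is_trig g -> is_trig (fun x => g x ^+ n).
Proof.
move=> tg; elim: n => [|n IH]; first by under eq_fun do rewrite expr0; exact: is_trig_cst.
by under eq_fun do rewrite exprS; exact: is_trigM.
Qed.

Lemma is_trig_sin (t a : R) : is_trig (fun x => sin (2 * pi * (t * x + a))).
Proof.
(* The factor 1/(2i) of Euler's formula for the sine. *)
pose c : R[i] := Complex 0 (- 2^-1).
exists [:: (c * cis2pi a, t); (- c * cis2pi (- a), - t)] => x.
rewrite /trig big_cons big_seq1 /= -[c * _ * _]mulrA -[- c * _ * _]mulrA -!cis2piD.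
have -> : - a + - t * x = - (a + t * x) by ring.
rewrite cis2piN (addrC a).
apply/eqP; rewrite eq_complex /=; apply/andP; split; apply/eqP; by field.
Qed.

End trig_polynomials.

(** * Polynomial approximation of a step *)

Section step_function.
Variable R : realType.

(* Kuhn's polynomials, corrected by a factor vanishing at t = 0, converge
   boundedly on [-1, 1] to the indicator of the negative numbers. *)
Definition kuhn (n : nat) (t : R) : R :=
  (1 - ((1 + t) / 2) ^+ n) ^+ (2 ^ n) * (1 - (1 - t ^+ 2) ^+ n).

Lemma kuhn_bound n t : -1 <= t <= 1 -> 0 <= kuhn n t <= 1.
Proof.
move=> /andP[t1 t2].
have a01 : 0 <= (1 + t) / 2 <= 1 by apply/andP; split; lra.
have b01 : 0 <= 1 - t ^+ 2 <= 1 by apply/andP; split; nra.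
have h (z : R) : 0 <= z <= 1 -> 0 <= 1 - z ^+ n <= 1.
  move=> /andP[z0 z1]; rewrite subr_ge0 exprn_ile1 //=.
  by rewrite lerBlDr lerDl exprn_ge0.
have /andP[A0 A1] := h _ a01; have /andP[B0 B1] := h _ b01.
rewrite /kuhn mulr_ge0 ?exprn_ge0 //=.
by rewrite mulr_ile1 ?exprn_ge0 // exprn_ile1.
Qed.

Lemma bernoulli_ineq (z : R) m : 0 <= z <= 1 -> 1 - m%:R * z <= (1 - z) ^+ m.
Proof.
move=> /andP[z0 z1]; elim: m => [|m IH]; first by rewrite mul0r subr0 expr0.
have m0 : 0 <= (m%:R : R) by [].
rewrite exprS -natr1; apply: le_trans (_ : (1 - z) * (1 - m%:R * z) <= _).
  by nra.
by rewrite ler_wpM2l // subr_ge0.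
Qed.

(** Combines (1 - z)^m (1 + z)^m <= 1 with m z <= (1 + z)^m. *)
Lemma bernoulli_ineq_inv (z : R) m : 0 <= z <= 1 ->
  (1 - z) ^+ m * (m%:R * z) <= 1.
Proof.
move=> /andP[z0 z1].
have : (1 - z) ^+ m * (1 + z) ^+ m <= 1.
  by rewrite -exprMn exprn_ile1 //; nra.
apply: le_trans; rewrite ler_wpM2l ?exprn_ge0 ?subr_ge0 //.
elim: m => [|m IH]; first by rewrite mul0r expr0.
have m0 : 0 <= (m%:R : R) by [].
have h1 : 1 <= (1 + z) ^+ m by rewrite exprn_ege1 // lerDl.
by rewrite exprS -natr1; nra.
Qed.

(** The exponents match: 2^n ((1 + t)/2)^n = (1 + t)^n. For t < 0 this tends to 0, and Bernoulli's
    inequality sends the first factor to 1; for t > 0 it tends to infinity, and the inverse bound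
    sends that factor to 0. At t = 0 the second factor vanishes. *)
Lemma kuhn_cvg t : -1 <= t <= 1 -> kuhn n t @[n --> \oo] --> ((t < 0)%R%:R : R).
Proof.
move=> t11; have /andP[t1 t2] := t11.
have [t0|t0|->] := ltgtP t 0; last first.
- rewrite (_ : (fun n => _) = (fun=> 0)); first exact: cvg_cst.
  by apply/funext => n; rewrite /kuhn expr0n /= subr0 expr1n subrr mulr0.
- have a0 : 0 < (1 + t) / 2 by lra.
  have a01 : 0 <= (1 + t) / 2 <= 1 by apply/andP; split; lra.
  apply: (@squeeze_cvgr _ _ _ _ (fun=> 0) (fun n => ((1 + t)^-1) ^+ n)).
  + apply: nearW => n; have /andP[-> _] /= := kuhn_bound n t11.
    have an : 0 <= ((1 + t) / 2) ^+ n <= 1.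
      by case/andP: a01 => u v; rewrite exprn_ge0 //= exprn_ile1.
    have := bernoulli_ineq_inv (2 ^ n) an.
    rewrite natrX -exprMn (_ : 2 * ((1 + t) / 2) = 1 + t); last by field.
    have pos : 0 < (1 + t) ^+ n by rewrite exprn_gt0 //; lra.
    rewrite -ler_pdivlMr // div1r => h; rewrite exprVn.
    apply: le_trans h; rewrite /kuhn ler_piMr ?exprn_ge0 ?subr_ge0 //.
      by case/andP: an.
    rewrite lerBlDr lerDl exprn_ge0 //; nra.
  + exact: cvg_cst.
  + apply: cvg_expr; rewrite ger0_norm ?invr_ge0; last by lra.
    by rewrite invf_lt1; lra.
- have a01 : 0 <= (1 + t) / 2 <= 1 by apply/andP; split; lra.
  have hA : (1 - ((1 + t) / 2) ^+ n) ^+ (2 ^ n) @[n --> \oo] --> (1 : R).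
    apply: (@squeeze_cvgr _ _ _ _ (fun n => 1 - (1 + t) ^+ n) (fun=> 1)).
    + apply: nearW => n.
      have an : 0 <= ((1 + t) / 2) ^+ n <= 1.
        by case/andP: a01 => u v; rewrite exprn_ge0 //= exprn_ile1.
      apply/andP; split.
        have := bernoulli_ineq (2 ^ n) an.
        by rewrite natrX -exprMn (_ : 2 * ((1 + t) / 2) = 1 + t) //; field.
      by case/andP: an => u v; rewrite exprn_ile1 ?subr_ge0 // lerBlDr lerDl.
    + rewrite -[X in _ --> X]subr0; apply: cvgB; first exact: cvg_cst.
      by apply: cvg_expr; rewrite ltr_norml; lra.
    + exact: cvg_cst.
  have hB : (1 - (1 - t ^+ 2) ^+ n) @[n --> \oo] --> (1 : R).
    rewrite -[X in _ --> X]subr0; apply: cvgB; first exact: cvg_cst.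
    by apply: cvg_expr; rewrite ltr_norml; nra.
  by rewrite -[X in _ --> X](mulr1 1); apply: cvgM.
Qed.

(** For large [k] the argument of the sine lies in (-pi, pi), where the sine has the sign of
    [a - x]. *)
Lemma sin_sign_cvg (a x : R) :
  ((sin (2 * pi * (k.+1%:R^-1 * (a - x))) < 0)%R%:R : R) @[k --> \oo] -->
  ((a < x)%R%:R : R).
Proof.
have pi0 : 0 < (pi : R) := pi_gt0 R.
have [ax|xa|->] := ltgtP a x.
- have : \forall k \near \oo, k.+1%:R^-1 < (2 * (x - a))^-1.
    by apply: near_infty_natSinv_lt (PosNum _); rewrite invr_gt0; lra.
  move=> h; apply: cvg_near_cst; apply: filterS h => k hk /=.
  rewrite (_ : sin _ < 0) // -oppr_gt0 -sinN sin_gt0_pi //.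
  have k0 : 0 < (k.+1%:R^-1 : R) by rewrite invr_gt0.
  set e := k.+1%:R^-1 in hk k0 *.
  have e1 : e * (2 * (x - a)) < 1 by rewrite -ltr_pdivlMr ?div1r //; lra.
  have -> : - (2 * pi * (e * (a - x))) = pi * (e * (2 * (x - a))) by ring.
  by rewrite mulr_gt0 ?mulr_gt0 //=; [rewrite gtr_pMr|lra].
- have : \forall k \near \oo, k.+1%:R^-1 < (2 * (a - x))^-1.
    by apply: near_infty_natSinv_lt (PosNum _); rewrite invr_gt0; lra.
  move=> h; apply: cvg_near_cst; apply: filterS h => k hk /=.
  rewrite ltNge (_ : 0 <= sin _) // ltW // sin_gt0_pi //.
  have k0 : 0 < (k.+1%:R^-1 : R) by rewrite invr_gt0.
  set e := k.+1%:R^-1 in hk k0 *.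
  have e1 : e * (2 * (a - x)) < 1 by rewrite -ltr_pdivlMr ?div1r //; lra.
  have -> : 2 * pi * (e * (a - x)) = pi * (e * (2 * (a - x))) by ring.
  by rewrite mulr_gt0 ?mulr_gt0 //=; [rewrite gtr_pMr|lra].
- rewrite (_ : (fun k => _) = (fun=> 0)); first exact: cvg_cst.
  by apply/funext => k; rewrite subrr !mulr0 sin0 ltxx.
Qed.

End step_function.

(** * Closed span of the exponentials with frequencies in [L] *)

Section closure.
Variables (R : realType) (mu : probability (measurableTypeR R) R).
Local Notation T := (measurableTypeR R).
Variable L : set R.

Definition cmeas (f : T -> R[i]) :=
  measurable_fun setT (fun x => complex.Re (f x)) /\
  measurable_fun setT (fun x => complex.Im (f x)).

Definition dist2 (f g : T -> R[i]) : \bar R :=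
  (\int[mu]_x (sqn (f x - g x))%:E)%E.

Definition approx (f : T -> R[i]) := forall eps : R, 0 < eps ->
  exists2 p, {in p, forall a, L a.2} & (dist2 f (trig p) < eps%:E)%E.

Lemma cmeasD f g : cmeas f -> cmeas g -> cmeas (fun x => f x + g x).
Proof.
move=> [f1 f2] [g1 g2]; split.
  by under eq_fun do rewrite ReD; exact: measurable_funD.
by under eq_fun do rewrite ImD; exact: measurable_funD.
Qed.

Lemma cmeasZ c f : cmeas f -> cmeas (fun x => c * f x).
Proof.
move=> [f1 f2]; split.
  have -> : (fun x => complex.Re (c * f x)) = (fun x =>
      complex.Re c * complex.Re (f x) - complex.Im c * complex.Im (f x)).
    by apply/funext => x; case: c; case: (f x).
  by apply: measurable_funB; apply: measurable_funM.
have -> : (fun x => complex.Im (c * f x)) = (fun x =>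
    complex.Re c * complex.Im (f x) + complex.Im c * complex.Re (f x)).
  by apply/funext => x; case: c; case: (f x).
by apply: measurable_funD; apply: measurable_funM.
Qed.

Lemma cmeasB f g : cmeas f -> cmeas g -> cmeas (fun x => f x - g x).
Proof.
move=> mf mg; have := cmeasD mf (cmeasZ (- 1) mg).
by under eq_fun do rewrite mulN1r.
Qed.

Lemma cmeasC (h : T -> R) : measurable_fun setT h -> cmeas (fun x => (h x)%:C%C).
Proof. by move=> mh; split => //=; exact: measurable_cst. Qed.

Lemma cmeas_cis t : cmeas (fun x => cis2pi (t * x)).
Proof. by split; [exact: measurable_cis_Re|exact: measurable_cis_Im]. Qed.

Lemma cmeas_trig p : cmeas (trig p).
Proof.
elim: p => [|a p IH]; rewrite /trig.
  by under eq_fun do rewrite big_nil; split; exact: measurable_cst.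
under eq_fun do rewrite big_cons; apply: cmeasD => //.
by apply: cmeasZ; exact: cmeas_cis.
Qed.

Lemma measurable_sqn f : cmeas f -> measurable_fun setT (fun x : T => sqn (f x)).
Proof.
by move=> [f1 f2]; apply: measurable_funD; apply: measurable_funX.
Qed.

Lemma measurable_dist2 f g : cmeas f -> cmeas g ->
  measurable_fun setT (fun x : T => (sqn (f x - g x))%:E).
Proof.
by move=> mf mg; apply/measurable_EFinP; apply: measurable_sqn; exact: cmeasB.
Qed.

(** A triangle inequality for squared distances, at the price of a factor 2; hence the tolerances
    [eps / 4] below. *)
Lemma dist2_le_add f g f1 g1 f2 g2 :
  cmeas f -> cmeas g -> cmeas f1 -> cmeas g1 -> cmeas f2 -> cmeas g2 ->
  (forall x, f x - g x = (f1 x - g1 x) + (f2 x - g2 x)) ->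
  (dist2 f g <= 2%:E * dist2 f1 g1 + 2%:E * dist2 f2 g2)%E.
Proof.
move=> mf mg mf1 mg1 mf2 mg2 e.
have m1 := measurable_dist2 mf1 mg1; have m2 := measurable_dist2 mf2 mg2.
rewrite /dist2 -!ge0_integralZl_EFin //; try by move=> x _; rewrite lee_fin sqn_ge0.
rewrite -ge0_integralD //; last 4 first.
- by move=> x _; rewrite -EFinM lee_fin mulr_ge0 ?sqn_ge0.
- exact: measurable_funeM.
- by move=> x _; rewrite -EFinM lee_fin mulr_ge0 ?sqn_ge0.
- exact: measurable_funeM.
apply: ge0_le_integral => //.
- by move=> x _; rewrite lee_fin sqn_ge0.
- exact: measurable_dist2.
- by apply: emeasurable_funD; exact: measurable_funeM.
- by move=> x _; rewrite -!EFinM -EFinD lee_fin e sqnD_le.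
Qed.

Let lte_half (a b : \bar R) (eps : R) : (a < (eps / 4)%:E)%E ->
  (b < (eps / 4)%:E)%E -> (2%:E * a + 2%:E * b < eps%:E)%E.
Proof.
move=> ha hb; have -> : eps%:E = (2%:E * (eps / 4)%:E + 2%:E * (eps / 4)%:E)%E.
  by rewrite -EFinM -EFinD; congr EFin; field.
by apply: lteD; rewrite lte_pmul2l.
Qed.

Lemma approxD f g : cmeas f -> cmeas g -> approx f -> approx g ->
  approx (fun x => f x + g x).
Proof.
move=> mf mg af ag eps e0; have e4 : 0 < eps / 4 by lra.
have [p pL pe] := af _ e4; have [q qL qe] := ag _ e4.
exists (p ++ q); first by move=> a; rewrite mem_cat => /orP[/pL|/qL].
apply: le_lt_trans (lte_half pe qe); apply: dist2_le_add => //.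
- exact: cmeasD.
- exact: cmeas_trig.
- exact: cmeas_trig.
- exact: cmeas_trig.
- by move=> x; rewrite trig_cat; ring.
Qed.

Lemma approxZ c f : cmeas f -> approx f -> approx (fun x => c * f x).
Proof.
move=> mf af eps e0; have c0 := sqn_ge0 c.
(* The added 1 covers the case [c = 0]. *)
have e1 : 0 < eps / (sqn c + 1) by rewrite divr_gt0 //; lra.
have [p pL pe] := af _ e1.
exists [seq (c * a.1, a.2) | a <- p].
  by move=> _ /mapP[a /pL ? ->].
have -> : dist2 (fun x => c * f x) (trig [seq (c * a.1, a.2) | a <- p]) =
    ((sqn c)%:E * dist2 f (trig p))%E.
  rewrite /dist2 -ge0_integralZl_EFin //; last 2 first.
  - by move=> x _; rewrite lee_fin sqn_ge0.
  - by apply: measurable_dist2 => //; exact: cmeas_trig.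
  by apply: eq_integral => x _; rewrite trig_scale -mulrBr sqnM EFinM.
apply: le_lt_trans (_ : ((sqn c)%:E * (eps / (sqn c + 1))%:E < _)%E).
  by rewrite lee_wpmul2l // ?lee_fin // ltW.
rewrite -EFinM lte_fin mulrA ltr_pdivrMr; last by lra.
by nra.
Qed.

Lemma approx0 : approx (fun=> 0).
Proof.
move=> eps e0; exists [::] => //; rewrite /dist2 integral0_eq ?lte_fin // => x _.
by rewrite /trig big_nil subr0 sqn0.
Qed.

Lemma approx_lim f : cmeas f ->
  (forall eps : R, 0 < eps -> exists g, [/\ cmeas g, approx g &
    (dist2 f g < eps%:E)%E]) -> approx f.
Proof.
move=> mf h eps e0; have e4 : 0 < eps / 4 by lra.
have [g [mg ag ge]] := h _ e4; have [p pL pe] := ag _ e4.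
exists p => //; apply: le_lt_trans (lte_half ge pe); apply: dist2_le_add => //.
- exact: cmeas_trig.
- exact: cmeas_trig.
- by move=> x; ring.
Qed.

(** Dominated convergence, applied to the squared differences, turns a pointwise limit into a limit
    in L^2. *)
Lemma approx_dominated (h_ : nat -> T -> R) (h : T -> R) (g : T -> R) :
  (forall n, measurable_fun setT (h_ n)) -> measurable_fun setT h ->
  mu.-integrable setT (EFin \o g) ->
  (forall n x, (h_ n x - h x) ^+ 2 <= g x) ->
  (forall x, h_ n x @[n --> \oo] --> h x) ->
  (forall n, approx (fun x => (h_ n x)%:C%C)) ->
  approx (fun x => (h x)%:C%C).
Proof.
move=> mh_ mh ig hg hcvg ah.
apply: approx_lim; first exact: cmeasC.
move=> eps e0.
pose F (n : nat) (x : T) : \bar R := ((h_ n x - h x) ^+ 2)%:E.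
have mF n : measurable_fun setT (F n).
  by apply/measurable_EFinP; apply: measurable_funX; apply: measurable_funB.
have FF : {ae mu, forall x, setT x -> F ^~ x @ \oo --> (0 : \bar R)%E}.
  apply: aeW => x _; rewrite /F; apply: cvg_EFin; first exact: nearW.
  have -> : (0 : R) = (h x - h x) ^+ 2 by rewrite subrr expr0n.
  by apply: cvgM; apply: cvgB => //; exact: cvg_cst.
have Fg : {ae mu, forall x n, setT x -> (`|F n x| <= (EFin \o g) x)%E}.
  by apply: aeW => x n _; rewrite /F /= lee_fin ger0_norm ?sqr_ge0.
have [_ _] := dominated_convergence measurableT mF (measurable_cst _) FF ig Fg.
rewrite integral0 => hF.
have [n hn] : exists n, (\int[mu]_x F n x < eps%:E)%E.
  have /fine_cvgP[[m _ fm] /cvgr_lt /(_ _ e0) [k _ hk]] := hF.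
  exists (maxn m k); have := hk _ (leq_maxr m k); have := fm _ (leq_maxl m k).
  by move=> /= /fineK {2}<-; rewrite lte_fin.
exists (fun x => (h_ n x)%:C%C); split => //; first exact: cmeasC.
apply: le_lt_trans hn; rewrite le_eqVlt; apply/orP; left; apply/eqP.
apply: eq_integral => x _; rewrite /F -rmorphB sqnC; congr EFin; ring.
Qed.

(** * Density in L^2 when the closure contains all exponentials *)

Hypothesis approx_cis : forall t, approx (fun x => cis2pi (t * x)).

Lemma approx_trig p : approx (trig p).
Proof.
elim: p => [|a p IH].
  rewrite (_ : trig [::] = fun=> 0); first exact: approx0.
  by apply/funext => x; rewrite /trig big_nil.
have -> : trig (a :: p) = (fun x => a.1 * cis2pi (a.2 * x) + trig p x).
  by apply/funext => x; rewrite /trig big_cons.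
apply: approxD => //.
- by apply: cmeasZ; exact: cmeas_cis.
- exact: cmeas_trig.
- by apply: approxZ => //; exact: cmeas_cis.
Qed.

Lemma approx_is_trig h : is_trig h -> approx (fun x => (h x)%:C%C).
Proof.
by move=> [p pE]; rewrite (_ : (fun _ => _) = trig p); [exact: approx_trig|exact/funext].
Qed.

Lemma approx_bounded_cvg (h_ : nat -> T -> R) (h : T -> R) :
  (forall n, measurable_fun setT (h_ n)) -> measurable_fun setT h ->
  (forall n x, 0 <= h_ n x <= 1) -> (forall x, 0 <= h x <= 1) ->
  (forall x, h_ n x @[n --> \oo] --> h x) ->
  (forall n, approx (fun x => (h_ n x)%:C%C)) ->
  approx (fun x => (h x)%:C%C).
Proof.
move=> mh_ mh b_ b hc ah; apply: (approx_dominated (g := cst 1) mh_ mh) => //.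
  by apply: (@bounded_integrable _ _ _ 1) => // x; rewrite normr1.
by move=> n x; have := b_ n x; have := b x; rewrite /cst => /andP[? ?] /andP[? ?]; nra.
Qed.

Lemma measurable_ray_sin (t a : R) : measurable_fun [set: T]
  (fun x : T => ((sin (2 * pi * (t * (a - x))) < 0)%R%:R : R)).
Proof.
pose s (x : R) := sin (2 * pi * (t * (a - x))).
have ms : measurable_fun [set: T] (s : T -> R).
  apply: continuous_measurable_fun => x.
  apply: continuous_comp; last exact: continuous_sin.
  apply: cvgM; first exact: cvg_cst.
  apply: cvgM; first exact: cvg_cst.
  by apply: cvgB; [exact: cvg_cst|exact: cvg_id].
have mA : measurable (s @^-1` `]-oo, 0[%classic : set T).
  by rewrite -[X in measurable X]setTI; apply: ms.
have := @measurable_indic _ T R setT _ mA.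
congr (measurable_fun _ _); apply/funext => x.
rewrite indicE; congr (_%:R); congr nat_of_bool.
by apply/idP/idP; rewrite inE /= in_itv /=.
Qed.

Lemma measurable_is_trig (h : R -> R) : is_trig h -> measurable_fun [set: T] (h : T -> R).
Proof.
move=> [p pE]; have [+ _] := cmeas_trig p.
by congr (measurable_fun _ _); apply/funext => x; rewrite -pE.
Qed.

(** Two bounded limits in succession: Kuhn's polynomials of a slow sine tend to the indicator of its
    negativity set, and these indicators tend to that of the ray. *)
Lemma approx_ray (a : R) : approx (fun x => (\1_(`]a, +oo[%classic : set R) x : R)%:C%C).
Proof.
have indE : (\1_(`]a, +oo[%classic : set R) : R -> R) = (fun x => (a < x)%R%:R).
  apply/funext => x; rewrite indicE; congr (_%:R); congr nat_of_bool.
  by apply/idP/idP; rewrite inE /= in_itv /= andbT.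
rewrite indE.
pose s k x : R := sin (2 * pi * (k.+1%:R^-1 * (a - x))).
have s1 k x : -1 <= s k x <= 1 by rewrite sin_geN1 sin_le1.
have tk n k : is_trig (fun x => kuhn n (s k x)).
  have ts : is_trig (s k).
    have := is_trig_sin (- k.+1%:R^-1) (k.+1%:R^-1 * a).
    congr is_trig; apply/funext => x; rewrite /s; congr sin; ring.
  have tc c := @is_trig_cst R c.
  apply: is_trigM.
    apply: is_trigX; apply: is_trigB => //; apply: is_trigX.
    by apply: is_trigM => //; apply: is_trigD.
  by apply: is_trigB => //; apply: is_trigX; apply: is_trigB => //; apply: is_trigX.
have ma : measurable_fun [set: T] (fun x : T => ((a < x)%R%:R : R)).
  rewrite -indE; apply: measurable_indic; exact: measurable_itv.
apply: (@approx_bounded_cvg (fun k x => ((s k x < 0)%R%:R : R))) => //.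
- by move=> k; exact: measurable_ray_sin.
- by move=> k x; case: ltP => _; rewrite ?ler01 ?lexx.
- by move=> x; case: ltP => _; rewrite ?ler01 ?lexx.
- by move=> x; exact: sin_sign_cvg.
move=> k; apply: (@approx_bounded_cvg (fun n x => kuhn n (s k x))).
- by move=> n; exact: measurable_is_trig.
- exact: measurable_ray_sin.
- by move=> n x; exact: kuhn_bound.
- by move=> x; case: ltP => _; rewrite ?ler01 ?lexx.
- by move=> x; exact: kuhn_cvg.
- by move=> n; exact: approx_is_trig.
Qed.

Let approxR (h : T -> R) := approx (fun x => (h x)%:C%C).

Lemma approxRD (g h : T -> R) : measurable_fun setT g -> measurable_fun setT h ->
  approxR g -> approxR h -> approxR (fun x => g x + h x).
Proof.
move=> mg mh ag ah; rewrite /approxR; under eq_fun do rewrite rmorphD.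
by apply: approxD => //; exact: cmeasC.
Qed.

Lemma approxRZ c (h : T -> R) : measurable_fun setT h ->
  approxR h -> approxR (fun x => c * h x).
Proof.
move=> mh ah; rewrite /approxR; under eq_fun do rewrite rmorphM.
by apply: approxZ => //; exact: cmeasC.
Qed.

(** Rays are stable under intersection and generate the Borel sets, and the sets with approximable
    indicator form a Dynkin system. *)
Lemma approx_indic (A : set T) : measurable A -> approxR (\1_A).
Proof.
have mind (B : set T) : measurable B -> measurable_fun setT (\1_B : T -> R).
  by move=> mB; exact: measurable_indic.
have b01 (B : set T) x : 0 <= (\1_B x : R) <= 1.
  by rewrite indicE; case: (_ \in _); rewrite ?ler01 ?lexx.
have ap1 : approxR (cst 1).
  apply: approx_is_trig; exact: is_trig_cst.
have mE : @measurable _ T = <<s @RGenOInfty.G R >> by exact: RGenOInfty.measurableE.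
rewrite mE; move: A; apply: (dynkin_induction mE).
- move=> A B [a ->] [b ->]; exists (Num.max a b).
  by apply/seteqP; split => x; rewrite /= !in_itv /= !andbT gt_max => /andP.
- by rewrite indicT.
- by move=> _ [a ->]; exact: approx_ray.
- move=> A mA aA.
  have -> : (\1_(~` A) : T -> R) = (fun x => cst 1 x + -1 * \1_A x).
    by apply/funext => x; rewrite !indicE in_setC; case: (x \in A) => /=; ring.
  apply: approxRD => //.
  - by apply: measurable_funM => //; exact: mind.
  - by apply: approxRZ => //; exact: mind.
move=> F mF tF aF.
pose S n : T -> R := \1_(\big[setU/set0]_(k < n) F k).
have mS n : measurable (\big[setU/set0]_(k < n) F k) by exact: bigsetU_measurable.
have aS n : approxR (S n).
  elim: n => [|n IH].
    rewrite /S big_ord0 indic0; exact: approx_is_trig (is_trig_cst 0).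
  have -> : S n.+1 = (fun x => S n x + \1_(F n) x).
    apply/funext => x; rewrite /S big_ord_recr /= !indicE in_setU.
    case: (boolP (x \in F n)) => xF; last by rewrite orbF addr0.
    rewrite orbT (negbTE (_ : x \notin _)) ?add0r //.
    (* Disjointness: a point of [F n] lies in no earlier [F k]. *)
    apply/negP => /set_mem; rewrite -bigcup_mkord => -[k /= kn Fk].
    have := tF k n I I; move/(_ (ex_intro _ x (conj Fk (set_mem xF)))) => e.
    by rewrite e ltnn in kn.
  by apply: approxRD => //; exact: mind.
apply: (@approx_bounded_cvg S).
- by move=> n; exact: mind.
- by apply: mind; exact: bigcup_measurable.
- by move=> n x; exact: b01.
- by move=> x; exact: b01.
- move=> x; apply: cvg_near_cst.
  have [[j _ Fj]|nF] := pselect ((\bigcup_k F k) x).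
    exists j.+1 => // n /= jn; rewrite /S !indicE !mem_set //; first by exists j.
    by rewrite -bigcup_mkord; exists j.
  apply: nearW => n; rewrite /S !indicE !memNset //.
  by rewrite -bigcup_mkord => -[k _ Fk]; apply: nF; exists k.
- exact: aS.
Qed.

Lemma approxR_sum (I : Type) (r : seq I) (h : I -> T -> R) :
  (forall i, measurable_fun setT (h i)) -> (forall i, approxR (h i)) ->
  approxR (fun x => \sum_(i <- r) h i x).
Proof.
move=> mh ah; elim: r => [|i r IH].
  rewrite (_ : (fun x => _) = fun=> 0); first exact: approx_is_trig (is_trig_cst 0).
  by apply/funext => x; rewrite big_nil.
rewrite (_ : (fun x => _) = fun x => h i x + \sum_(j <- r) h j x); last first.
  by apply/funext => x; rewrite big_cons.
by apply: approxRD => //; exact: measurable_sum.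
Qed.

Import HBNNSimple.

Lemma approx_nnsfun (f : {nnsfun T >-> R}) : approxR f.
Proof.
rewrite (_ : (f : T -> R) = fun x => \sum_(i <- index_enum 'I_(#|` fset_set (range f)|))
    (fset_set (range f))`_i * \1_(f @^-1` [set (fset_set (range f))`_i]) x); last first.
  by apply/funext => x; rewrite fimfunEord.
have mi (c : R) : measurable (f @^-1` [set c]).
  by rewrite -[X in measurable X]setTI; apply: measurable_funPT.
apply: approxR_sum => i.
  by apply: measurable_funM => //; exact: measurable_indic.
by apply: approxRZ; [exact: measurable_indic|exact: approx_indic].
Qed.

(** Simple functions increase to [f], and their squared distance to [f] is at most [f ^+ 2], an
    integrable majorant. *)
Lemma approx_ge0 (f : T -> R) : measurable_fun setT f -> (forall x, 0 <= f x) ->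
  mu.-integrable setT (EFin \o (fun x => f x ^+ 2)) -> approxR f.
Proof.
move=> mf f0 i2.
have mfE : measurable_fun setT (EFin \o f) by exact/measurable_EFinP.
pose f_ := nnsfun_approx measurableT mfE.
have cv x : f_ n x @[n --> \oo] --> f x.
  have := cvg_nnsfun_approx measurableT mfE (fun x _ => f0 x) (x := x) I.
  by move/fine_cvgP => [].
have nd x : nondecreasing_seq (f_ ^~ x).
  by move=> m n mn; have /lefP := nd_nnsfun_approx measurableT mfE mn; apply.
have le n x : f_ n x <= f x.
  by rewrite -(cvg_lim _ (cv x)) //; apply: nondecreasing_cvgn_le => //; apply/cvg_ex; exists (f x).
apply: (approx_dominated (h_ := fun n => f_ n) _ mf i2) => //.
- move=> n x; have a0 : 0 <= f_ n x by exact: fun_ge0.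
  have : 0 <= f_ n x * (f x - f_ n x) by rewrite mulr_ge0 // subr_ge0.
  have := f0 x; move: a0 (le n x); generalize (f_ n x) (f x) => a b; nra.
- by move=> n; exact: approx_nnsfun.
Qed.

Lemma approx_real (f : T -> R) : measurable_fun setT f ->
  mu.-integrable setT (EFin \o (fun x => f x ^+ 2)) -> approxR f.
Proof.
move=> mf i2.
have key (g : T -> R) : measurable_fun setT g -> (forall x, g x ^+ 2 <= f x ^+ 2) ->
    mu.-integrable setT (EFin \o (fun x => g x ^+ 2)).
  move=> mg gf; apply: (le_integrable measurableT _ _ i2).
    by apply/measurable_EFinP; apply: measurable_funX.
  by move=> x _ /=; rewrite lee_fin !ger0_norm ?sqr_ge0.
rewrite (_ : f = fun x => f^\+ x + -1 * f^\- x)%R; last first.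
  apply/funext => x; rewrite /funrpos /funrneg.
  by case: (leP (f x) 0) => ?; case: (leP (- f x) 0) => ?; lra.
have mp := measurable_funrpos mf; have mn := measurable_funrneg mf.
apply: approxRD => //; first by apply: measurable_funM.
  apply: approx_ge0 => //; apply: key => // x.
  by rewrite /funrpos; case: (leP (f x) 0) => ?; nra.
apply: approxRZ => //; apply: approx_ge0 => //; apply: key => // x.
by rewrite /funrneg; case: (leP (- f x) 0) => ?; nra.
Qed.

Lemma approx_L2 (f : T -> R[i]) : cmeas f ->
  mu.-integrable setT (EFin \o (fun x => sqn (f x))) -> approx f.
Proof.
move=> [mR mI] i2.
have key (g : T -> R) : measurable_fun setT g -> (forall x, g x ^+ 2 <= sqn (f x)) ->
    mu.-integrable setT (EFin \o (fun x => g x ^+ 2)).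
  move=> mg gf; apply: (le_integrable measurableT _ _ i2).
    by apply/measurable_EFinP; apply: measurable_funX.
  by move=> x _ /=; rewrite lee_fin !ger0_norm ?sqr_ge0 ?sqn_ge0.
rewrite (_ : f = fun x => (complex.Re (f x))%:C%C +
    Complex 0 1 * (complex.Im (f x))%:C%C); last first.
  by apply/funext => x; rewrite {1}[f x]complexE.
apply: approxD.
- exact: cmeasC.
- by apply: cmeasZ; exact: cmeasC.
- by apply: approx_real => //; apply: key => // x; rewrite lerDl sqr_ge0.
- apply: approxZ; first exact: cmeasC.
  by apply: approx_real => //; apply: key => // x; rewrite lerDr sqr_ge0.
Qed.

End closure.

(** * Spectra *)

Section spectrum.
Variables (R : realType) (mu : probability (measurableTypeR R) R).
Local Notation T := (measurableTypeR R).

Lemma L2norm_sqr (f : T -> R[i]) :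
  (L2norm mu f `^ 2 = \int[mu]_x (sqn (f x))%:E)%E.
Proof.
rewrite /L2norm poweR_Lnorm ?pnatr_eq0 //; apply: eq_integral => x _.
have n0 : 0 <= Normc.normc (f x) by case: (f x) => a b; exact: sqrtr_ge0.
rewrite -normc_sqr abse_EFin ger0_norm // poweR_EFin; congr EFin.
by rewrite powR_mulrn.
Qed.

Lemma L2norm_lt (f : T -> R[i]) (eps : R) : 0 < eps ->
  (\int[mu]_x (sqn (f x))%:E < (eps ^+ 2)%:E)%E -> (L2norm mu f < eps%:E)%E.
Proof.
move=> e0; rewrite -L2norm_sqr !ltNge; apply: contra => h.
have -> : (eps ^+ 2)%:E = (eps%:E `^ 2)%E.
  by rewrite poweR_EFin powR_mulrn // ltW.
apply: gt0_ler_poweR => //.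
- by rewrite in_itv /= lee_fin ltW //= leey.
- by rewrite in_itv /= Lnorm_ge0 leey.
Qed.

Lemma L2norm_lty (f : T -> R[i]) :
  (L2norm mu f < +oo)%E = (\int[mu]_x (sqn (f x))%:E < +oo)%E.
Proof.
rewrite -L2norm_sqr; apply/idP/idP; first exact: poweR_lty.
rewrite !ltey; apply: contra => /eqP ->.
by rewrite poweRyr // pnatr_eq0.
Qed.

(** The Gram form of the exponentials: the squared modulus of a trigonometric polynomial is again
    one, with the differences as frequencies. *)
Lemma integral_sqn_trig (p : seq (R[i] * R)) :
  (\int[mu]_x (sqn (trig p x))%:E = (complex.Re (\sum_(a <- p) \sum_(b <- p)
     a.1 * conjc b.1 * ft mu (a.2 - b.2)))%:E)%E.
Proof.
pose pp := [seq (a.1 * conjc b.1, a.2 - b.2) | a <- p, b <- p].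
have sqE x : sqn (trig p x) = complex.Re (\sum_(a <- pp) a.1 * cis2pi (a.2 * x)).
  rewrite sqn_Re /pp big_allpairs_dep /trig raddf_sum mulr_suml.
  congr complex.Re; apply: eq_bigr => a _; rewrite mulr_sumr.
  apply: eq_bigr => b _; rewrite mulrBl cis2piD cis2piN /= rmorphM /=; ring.
have -> : \sum_(a <- p) \sum_(b <- p) a.1 * conjc b.1 * ft mu (a.2 - b.2) =
    \sum_(a <- pp) a.1 * ft mu a.2.
  by rewrite /pp big_allpairs_dep.
rewrite -integral_Re_trig /Rintegral fineK.
  by apply: eq_integral => x _; rewrite sqE.
apply: integrable_fin_num => //.
apply: (@bounded_integrable _ _ _ (\sum_(a <- pp) (`|complex.Re a.1| + `|complex.Im a.1|))).
  have [+ _] := cmeas_trig pp; exact.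
move=> x; rewrite Re_sum; apply: le_trans (ler_norm_sum _ _ _) _.
apply: ler_sum => a _; case: a.1 => u v /=.
apply: le_trans (ler_normB _ _) _; rewrite !normrM.
apply: lerD; rewrite ler_piMr // ler_norml.
  by rewrite cos_geN1 cos_le1.
by rewrite sin_geN1 sin_le1.
Qed.

Variable L : set R.
Hypothesis orth : forall x y, L x -> L y -> x != y -> ft mu (x - y) = 0.

(** The approximant is the orthogonal expansion of e(t x) over [W]; orthogonality makes its squared
    error 1 minus the sum of the squared coefficients. *)
Lemma approx_parseval (t : R) :
  (forall eps : R, 0 < eps -> exists W : seq R, [/\ uniq W, {in W, forall x, L x} &
     1 - eps < \sum_(x <- W) sqn (ft mu (t - x))]) ->
  approx mu L (fun x => cis2pi (t * x)).
Proof.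
move=> h eps e0; have [W [uW WL hW]] := h _ e0.
pose c x := ft mu (t - x).
exists [seq (c x, x) | x <- W]; first by move=> _ /mapP[x xW ->]; exact: WL.
(* The error itself, written as a trigonometric polynomial. *)
pose p := (1, t) :: [seq (- c x, x) | x <- W].
have -> : dist2 mu (fun x => cis2pi (t * x)) (trig [seq (c x, x) | x <- W]) =
    (\int[mu]_x (sqn (trig p x))%:E)%E.
  apply: eq_integral => x _; congr (sqn _)%:E.
  rewrite /p /trig big_cons !big_map /= mul1r; congr (_ + _).
  by rewrite -sumrN; apply: eq_bigr => y _; rewrite mulNr.
rewrite integral_sqn_trig lte_fin /p.
have cJ x : ft mu (x - t) = conjc (c x) by rewrite -ftN opprB.
pose S : R := \sum_(x <- W) sqn (c x).
have SE : (S%:C%C : R[i]) = \sum_(x <- W) c x * conjc (c x).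
  by under [RHS]eq_bigr do rewrite -sqnE; rewrite rmorph_sum.
suff -> : \sum_(a <- (1, t) :: [seq (- c x, x) | x <- W])
    \sum_(b <- (1, t) :: [seq (- c x, x) | x <- W])
    a.1 * conjc b.1 * ft mu (a.2 - b.2) = (1 - S)%:C%C.
  by rewrite /= /S; move: hW; rewrite /c; lra.
rewrite big_cons big_map [X in X + _]big_cons big_map; cbn [fst snd].
have -> : (1 - S)%:C%C = 1 - S%:C%C :> R[i].
  by apply/eqP; rewrite eq_complex /= subrr !eqxx.
rewrite subrr ft0 conjc1 !mulr1 SE -addrA; congr (_ + _).
rewrite -sumrN -big_split /= big_seq [RHS]big_seq; apply: eq_bigr => x xW.
rewrite big_cons big_map; cbn [fst snd]; rewrite conjc1 mulr1 cJ mul1r.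
rewrite (bigD1_seq x) //= subrr ft0 big_seq_cond big1 => [|y /andP[yW yx]].
  rewrite -/(c x); case: (c x) => a b /=; apply/eqP; rewrite eq_complex /=.
  by apply/andP; split; apply/eqP; ring.
by rewrite orth ?mulr0 //; [exact: WL|exact: WL|rewrite eq_sym].
Qed.

Lemma is_spectrum_total : (forall t, approx mu L (fun x => cis2pi (t * x))) ->
  is_spectrum mu L.
Proof.
move=> ap; split.
- move=> t _; split.
  + exact: measurable_cis_Re.
  + exact: measurable_cis_Im.
  + rewrite L2norm_lty (eq_integral (cst 1%E)) => [|x _]; last by rewrite sqn_cis.
    rewrite integral_cst // mul1e.
    by apply: le_lt_trans (probability_le1 mu measurableT) (ltry _).
- move=> x y Lx Ly; rewrite L2dot_cis.
  by have [->|xy] := eqVneq x y; [rewrite subrr ft0|rewrite orth].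
move=> f [fR fI fL] eps e0.
have cf : cmeas f by [].
have if2 : mu.-integrable setT (EFin \o (fun x => sqn (f x))).
  apply/integrableP; split.
    by apply/measurable_EFinP; exact: measurable_sqn.
  move: fL; rewrite L2norm_lty; congr (_ < _)%E.
  by apply: eq_integral => x _; rewrite /= ger0_norm ?sqn_ge0.
have e2 : 0 < eps ^+ 2 by rewrite exprn_gt0.
have [p pL pe] := approx_L2 ap cf if2 e2.
(* Coefficients of equal frequency are added up, since the combination must be indexed by a finite
   set. *)
exists [fset a.2 | a in p]%fset, (fun x => \sum_(a <- p | a.2 == x) a.1); split.
  by move=> x /imfsetP[a /= ap' ->]; exact: pL.
apply: L2norm_lt => //; apply: le_lt_trans pe; rewrite le_eqVlt; apply/orP; left.
apply/eqP; apply: eq_integral => x _; congr (sqn (_ - _))%:E.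
rewrite /trig; under eq_bigr do rewrite mulr_suml.
rewrite (exchange_big_dep xpredT) //= big_seq [RHS]big_seq.
apply: eq_bigr => a ap'; rewrite big_mkcond (bigD1_seq a.2) /=; last 2 first.
- by apply/imfsetP; exists a.
- exact: fset_uniq.
rewrite eqxx big1 ?addr0 // => y; rewrite eq_sym => /negbTE -> //.
Qed.

End spectrum.

(** * Digit sums as a spectrum *)

Section digit_spectrum.
Variables (R : realType) (mu : probability (measurableTypeR R) R).
Variables (N : R) (S : seq R) (M : R -> R) (u : R) (P : R -> Prop).
Hypothesis N2 : 2 <= `|N|.
Hypothesis u0 : 0 < u.
Hypothesis S0 : 0 \in S.
Hypothesis P0 : P 0.
Hypothesis PB : forall x y, P x -> P y -> P (x - y).
Hypothesis PN : forall x, P x -> P (N * x).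
Hypothesis SP : {in S, forall s, P s}.
Hypothesis M_ge0 : forall x, 0 <= M x.
Hypothesis M0 : M 0 = 1.
Hypothesis MP : forall x p, P p -> M (x + p) = M x.
Hypothesis Msum : forall x, \sum_(s <- S) M ((x + s) / N) = 1.
Hypothesis M_cts : continuous M.
Hypothesis ftM : forall x, sqn (ft mu x) = M (x / N) * sqn (ft mu (x / N)).
Hypothesis Sbnd : {in S, forall s, `|s| <= u * (`|N| - 2)}.
Hypothesis M_zeros : forall r : R, finite_set [set x : R | `|x| <= r /\ M x = 0].
Hypothesis M_peak : forall y : R, `|y| < u -> M y = 1 ->
  forall k : nat, M (y / N ^+ k) != 0.

Definition digit_sums : set R := [set x | exists2 w, all (mem S) w & x = lam N w].

Let G t := sqn (ft mu t).

Let G0 : G 0 = 1. Proof. by rewrite /G ft0 sqn1. Qed.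

(** The squared norm of 1 - conj(ft t) e(t x) is 1 - |ft t|^2. *)
Let G_le1 t : G t <= 1.
Proof.
have := integral_sqn_trig mu [:: (1, 0); (- conjc (ft mu t), t)].
have : (0 <= \int[mu]_x (sqn (trig [:: (1, 0); (- conjc (ft mu t), t)] x))%:E)%E.
  by apply: integral_ge0 => x _; rewrite lee_fin sqn_ge0.
move=> /[swap] ->; rewrite lee_fin !big_cons !big_nil; cbn [fst snd].
rewrite !addr0 !subrr ft0 subr0 sub0r.
rewrite ftN conjc1 /G /sqn; case: (ft mu t) => a b /=.
by nra.
Qed.

Lemma lam_pad w k : lam N (w ++ nseq k 0) = lam N w.
Proof.
elim: w => [|s w IH] /=; last by rewrite IH.
by elim: k => //= k ->; rewrite mulr0 addr0.
Qed.

Lemma is_spectrum_digits : is_spectrum mu digit_sums.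
Proof.
have orth x y : digit_sums x -> digit_sums y -> x != y -> ft mu (x - y) = 0.
  move=> [w wS ->] [v vS ->] wv.
  (* [G_lam] compares words of equal length, so both are padded with zeros to length
     [size w + size v]. *)
  pose w' := w ++ nseq (size v) 0; pose v' := v ++ nseq (size w) 0.
  rewrite -(lam_pad w (size v)) -(lam_pad v (size w)) -/w' -/v'.
  have pS (z : seq R) k : all (mem S) z -> all (mem S) (z ++ nseq k 0).
    by move=> zS; rewrite all_cat zS all_nseq /= S0 orbT.
  apply/eqP; rewrite -sqn_eq0; apply/eqP.
  apply: (@G_lam R N S M G P) => //; try exact: pS.
    by rewrite !size_cat !size_nseq addnC.
  apply: contra wv => /eqP e.
  by rewrite -(lam_pad w (size v)) -(lam_pad v (size w)) -/w' -/v' e.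
apply: is_spectrum_total => // t; apply: approx_parseval => // eps e0.
(* The point is [- t] because the transfer sums run over [x + lam N w], and [approx_parseval] over
   [t - lam N w]; [ftN] reconciles the two. *)
have [] := @transfer_total R N S M G u P N2 u0 S0 P0 PB PN SP M_ge0 M0 MP Msum
  M_cts (fun x => sqn_ge0 _) G0 G_le1 ftM (@ft_continuous _ mu) Sbnd M_zeros M_peak
  (- t) eps e0.
move=> n hn; exists [seq lam N w | w <- words S n]; split.
- rewrite map_inj_in_uniq => [|w v]; first by apply: words_uniq; exact: digits_uniq Msum.
  rewrite !mem_words => /andP[/eqP sw wS] /andP[/eqP sv vS].
  by apply: (@lam_inj R N S M G P) => //; rewrite sw sv.
- by move=> _ /mapP[w + ->]; rewrite mem_words => /andP[_ wS]; exists w.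
- rewrite big_map; congr (_ < _): hn; apply: eq_bigr => w _.
  by rewrite /G -sqn_conj -ftN opprD opprK.
Qed.

End digit_spectrum.

(** * Consequences of compatibility *)

Section compatible.
Variables (R : realType) (N : int) (D S : {fset int}).
Hypothesis N0 : N != 0.
Hypothesis hcomp : compatible_pair (fset_scaled R N D) (fset_of_ints R S).
Local Notation SR := (enum_fset (fset_of_ints R S)).

Lemma card_compatible : #|` fset_of_ints R S| = #|` D|.
Proof.
have [<- _] := hcomp; rewrite card_imfset //= => x y /divIf; rewrite intr_eq0.
by move=> /(_ N0) /intr_inj.
Qed.

(** Orthogonality of the rows [d / N] and [d' / N] of the unitary matrix, after cancelling the
    normalization. *)
Lemma compatible_orth d d' : d \in D -> d' \in D -> d != d' ->
  \sum_(s <- SR) cis2pi ((d - d')%:~R / N%:~R * s : R) = 0.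
Proof.
move=> dD dD' dd'; have [cAS /unitarymxP] := hcomp.
set A := fset_scaled R N D; set q := #|` A|.
have mA e : e \in D -> (e%:~R / N%:~R : R) \in enum_fset A.
  by move=> eD; apply/imfsetP; exists e.
have iA e (eD : e \in D) : (index (e%:~R / N%:~R : R) (enum_fset A) < q)%N.
  by rewrite index_mem mA.
move=> /matrixP /(_ (Ordinal (iA d dD)) (Ordinal (iA d' dD'))).
rewrite !mxE /= -val_eqE /= (_ : (index _ _ == index _ _) = false); last first.
  apply/negbTE; apply: contra dd' => /eqP /(congr1 (nth 0 (enum_fset A))).
  rewrite !nth_index ?mA // => /divIf; rewrite intr_eq0 => /(_ N0) /intr_inj ->.
  exact: eqxx.
rewrite mulr0n => h.
have q0 : (Num.sqrt (q%:R : R))^-1%:C%C != 0 :> R[i].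
  rewrite fmorph_eq0 invr_eq0 sqrtr_eq0 -ltNge ltr0n.
  by apply: leq_ltn_trans (iA d dD).
apply: (mulfI q0); apply: (mulfI q0); rewrite !mulr0 -[RHS]h.
rewrite (big_nth 0) big_mkord !mulr_sumr; apply: eq_bigr => k _.
rewrite !mxE /= !nth_index ?mA //.
have -> z : Num.conj z = conjc z :> R[i] by [].
have -> (z w : R[i]) : conjc (z * w) = conjc z * conjc w by exact: rmorphM.
rewrite conjc_real -cis2piN.
have -> : ((d - d')%:~R / N%:~R * SR`_k : R) =
  d%:~R / N%:~R * SR`_k + - (d'%:~R / N%:~R * SR`_k) by rewrite intrB; ring.
by rewrite cis2piD; ring.
Qed.

(** In the expansion [mask2E], pairs of distinct digits cancel by [compatible_orth]; each of the q
    diagonal pairs contributes q, against the factor 1/q^2. *)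
Lemma compatible_sum (D0 : D != fset0) (x : R) :
  \sum_(s <- SR) mask2 (enum_fset D) ((x + s) / N%:~R) = 1.
Proof.
have D0' : enum_fset D != [::].
  by apply: contra D0 => /eqP Dn; rewrite -cardfs_eq0 /= Dn.
have q0 : (size (enum_fset D))%:R != 0 :> R by rewrite pnatr_eq0 size_eq0.
under eq_bigr do rewrite mask2E.
rewrite -mulr_sumr exchange_big big_seq.
rewrite (eq_bigr (fun=> (size (enum_fset D))%:R)) => [|d dD].
  rewrite -big_seq big_const_seq count_predT iter_addr_0.
  by rewrite -[X in _ * X]mulr_natr -expr2 -exprMn mulVf // expr1n.
rewrite exchange_big.
pose F d' : R := \sum_(s <- SR) complex.Re (cis2pi ((d - d')%:~R * ((x + s) / N%:~R))).
transitivity (F d + \sum_(d' <- enum_fset D | d' != d) F d').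
  exact: (bigD1_seq d dD (fset_uniq D)).
rewrite big_seq_cond big1 => [|d' /andP[dD' dd']]; rewrite ?addr0 /F.
  under eq_bigr do rewrite subrr mul0r cis2pi0.
  by rewrite big_const_seq count_predT iter_addr_0 /= -card_compatible.
rewrite -Re_sum; under eq_bigr => s _.
  have -> : (d - d')%:~R * ((x + s) / N%:~R) =
    (d - d')%:~R * (x / N%:~R) + (d - d')%:~R / N%:~R * s :> R by ring.
  rewrite cis2piD; over.
by rewrite -mulr_sumr compatible_orth ?mulr0 // eq_sym.
Qed.

End compatible.

(** * The dual lattice and its generator *)

Section dual.
Variables (R : realType) (D : {fset int}).
Local Notation Ds := (enum_fset D).

Lemma dual_lattice0 : dual_lattice Ds (0 : R).
Proof. by move=> d d' _ _; rewrite mulr0 rpred0. Qed.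

Lemma dual_latticeB (x y : R) : dual_lattice Ds x -> dual_lattice Ds y ->
  dual_lattice Ds (x - y).
Proof. by move=> hx hy d d' dD dD'; rewrite mulrBr rpredB ?hx ?hy. Qed.

Lemma dual_latticeMz (k : int) (x : R) : dual_lattice Ds x ->
  dual_lattice Ds (k%:~R * x).
Proof. by move=> hx d d' dD dD'; rewrite mulrCA rpredM ?intr_int ?hx. Qed.

Lemma dual_lattice_int (k : int) : dual_lattice Ds (k%:~R : R).
Proof. by move=> d d' _ _; rewrite -intrM intr_int. Qed.

Lemma gcd_fset_dvd (A : {fset int}) a : a \in A -> (gcd_fset A %| a)%Z.
Proof.
move=> aA; have {aA} : a \in enum_fset A by [].
rewrite /gcd_fset; elim: (enum_fset A) => [//|b s IH].
rewrite inE big_cons => /orP[/eqP ->|/IH]; first exact: dvdz_gcdl.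
by apply: dvdz_trans; exact: dvdz_gcdr.
Qed.

(** By Bezout, the gcd is an integer combination of the elements. *)
Lemma gcd_fset_span (A : {fset int}) (y : R) :
  {in A, forall a : int, a%:~R * y \is a Num.int} -> (gcd_fset A)%:~R * y \is a Num.int.
Proof.
move=> h; rewrite /gcd_fset big_seq; elim/big_rec: _ => [|a g aA ig].
  by rewrite mul0r rpred0.
have [u [v <-]] := Bezoutz a g.
rewrite intrD !intrM mulrDl -!mulrA.
by apply: rpredD; apply: rpredM; rewrite ?intr_int //; exact: h.
Qed.

Lemma diff_fsetP d d' : d \in D -> d' \in D -> d - d' \in diff_fset D.
Proof. by move=> dD dD'; apply/imfset2P; exists d => //; exists d'. Qed.

Lemma dual_lattice_gcd (y : R) :
  dual_lattice Ds y <-> (gcd_fset (diff_fset D))%:~R * y \is a Num.int.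
Proof.
split=> [hy|hy d d' dD dD'].
  apply: gcd_fset_span => a /imfset2P[d dD [d' dD' ->]]; exact: hy.
have /dvdzP[k ->] := gcd_fset_dvd (diff_fsetP dD dD').
by rewrite intrM -mulrA rpredM ?intr_int.
Qed.

Lemma mask2_le1 (t : R) : Ds != [::] -> mask2 Ds t <= 1.
Proof.
move=> D0; have q0 : (size Ds)%:R != 0 :> R by rewrite pnatr_eq0 size_eq0.
rewrite mask2E exprVn mulrC ler_pdivrMr ?mul1r; last first.
  by rewrite exprn_gt0 // lt_def q0 ler0n.
have -> : (size Ds)%:R ^+ 2 = \sum_(d <- Ds) \sum_(d' <- Ds) (1 : R).
  by rewrite !big_const_seq !count_predT !iter_addr_0 -mulrnA natrM expr2.
by apply: ler_sum => d _; apply: ler_sum => d' _; exact: cos_le1.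
Qed.

(* The convention 1/g = 1 is used when D is a singleton, in which case g = 0. *)
Definition dual_unit : R :=
  let g := gcd_fset (diff_fset D) in if g == 0 then 1 else `|g%:~R|^-1.

Lemma dual_unit_gt0 : 0 < dual_unit.
Proof.
rewrite /dual_unit; case: eqVneq => // g0.
by rewrite invr_gt0 normr_gt0 intr_eq0.
Qed.

Lemma dual_unitP (k : int) : dual_lattice Ds (k%:~R * dual_unit).
Proof.
apply/dual_lattice_gcd; rewrite /dual_unit; case: eqVneq => [->|g0].
  by rewrite mul0r rpred0.
rewrite mulrCA rpredM ?intr_int //.
have g0' : (gcd_fset (diff_fset D))%:~R != 0 :> R by rewrite intr_eq0.
case: (ger0P ((gcd_fset (diff_fset D))%:~R : R)) => _; first by rewrite mulfV // rpred1.
by rewrite invrN mulrN mulfV // rpredN rpred1.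
Qed.

(** If the gcd is 0, the dual lattice is all of [R] and [mask2] is constant. Otherwise [y] is a
    lattice point closer to 0 than the generator, so [y = 0]. The scalar [p] will be built from
    powers of [N]. *)
Lemma mask2_small_peak (y : R) : Ds != [::] -> `|y| < dual_unit -> mask2 Ds y = 1 ->
  forall p : R, mask2 Ds (p * y) = 1.
Proof.
move=> D0 + /(mask2_peak D0) /dual_lattice_gcd hy p.
rewrite /dual_unit; case: eqVneq => [g0 _|g0 yg].
  rewrite -[p * y]add0r mask2_period ?mask2_0 //.
  by apply/dual_lattice_gcd; rewrite g0 mul0r rpred0.
have -> : y = 0; last by rewrite mulr0 mask2_0.
move: hy => /intrP[k hk].
have k1 : `|k%:~R : R| < 1.
  rewrite -hk normrM -ltr_pdivlMl ?normr_gt0 ?intr_eq0 // mulr1.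
  exact: yg.
have k0 : k = 0.
  by move: k1; rewrite -intr_norm -[1]/(1%:~R) ltr_int; lia.
move/eqP: hk; rewrite k0 mulf_eq0 intr_eq0 (negbTE g0) => /eqP. exact.
Qed.

End dual.

(** * [Lambda] as a set of digit sums *)

Section lambda.
Variables (R : realType).

Lemma lamE (N : R) w : lam N w = \sum_(j < size w) w`_j * N ^+ j.
Proof.
elim: w => [|s w IH] /=; first by rewrite big_ord0.
rewrite big_ord_recl /= expr0 mulr1 IH mulr_sumr; congr (_ + _).
by apply: eq_bigr => j _; rewrite exprS mulrCA.
Qed.

Lemma Lambda_digits (N : int) (A : {fset R}) : 0 \in A ->
  Lambda N A = digit_sums N%:~R (enum_fset A).
Proof.
move=> A0; apply/seteqP; split=> x.
  move=> [k [a [k1 aA] ->]]; exists [seq a j | j <- enum 'I_k.+1].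
    by apply/allP => _ /mapP[j _ ->]; exact: aA.
  rewrite lamE size_map size_enum_ord; apply: eq_bigr => j _.
  by rewrite (nth_map ord0) ?size_enum_ord // nth_ord_enum.
(* [1 <= k] means at least two digits; two appended zeros supply them even for the empty word. *)
move=> [w wA ->]; pose w' := w ++ nseq 2 0.
have sw : size w' = (size w).+2 by rewrite size_cat size_nseq addn2.
exists (size w).+1, (fun j => w'`_j).
  split=> // j; have : w'`_j \in w' by rewrite mem_nth // sw.
  rewrite mem_cat => /orP[/(allP wA) //|]; by rewrite mem_nseq => /andP[_ /eqP ->].
by rewrite -(lam_pad N%:~R w 2) lamE -/w' sw.
Qed.

End lambda.

(** * The two conclusions *)

Section main.
Variables (R : realType) (N : int) (D S : {fset int}).
Variable mu : probability (measurableTypeR R) R.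
Hypothesis hN : (1 < `|N|)%R.
Hypothesis hmu : is_self_similar N D mu.
Hypothesis hS0 : (0 : int)%R \in S.
Hypothesis hcomp : compatible_pair (fset_scaled R N D) (fset_of_ints R S).
Local Notation Ds := (enum_fset D).
Local Notation SR := (enum_fset (fset_of_ints R S)).

Let N0 : N != 0. Proof. by lia. Qed.

Let NR0 : N%:~R != 0 :> R. Proof. by rewrite intr_eq0. Qed.

Let N2 : 2 <= `|N%:~R : R|.
Proof. by rewrite -intr_norm -[2]/(2%:~R) ler_int; lia. Qed.

Let SR0 : (0 : R) \in SR.
Proof. by apply/imfsetP; exists 0. Qed.

Let Dpos : (0 < #|` D|)%N.
Proof.
by rewrite -(card_compatible N0 hcomp) cardfs_gt0; apply/fset0Pn; exists 0.
Qed.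

Let D0 : D != fset0. Proof. by rewrite -cardfs_gt0. Qed.

Let Ds0 : Ds != [::]. Proof. by rewrite -size_eq0 -lt0n. Qed.

Let SRP s : s \in SR -> exists2 k : int, k \in S & s = k%:~R.
Proof. by move=> /imfsetP[k /= kS ->]; exists k. Qed.

Let ft_mask x : sqn (ft mu x) = mask2 Ds (x / N%:~R) * sqn (ft mu (x / N%:~R)).
Proof. by rewrite (ft_self_similar hmu Dpos N0) sqnM. Qed.

Lemma Lambda_spectrum : gcd_fset (diff_fset D) = 1%R ->
  (forall s : int, s \in S -> (2 - `|N| <= s <= `|N| - 2)%R) ->
  is_spectrum mu (Lambda N (fset_of_ints R S)).
Proof.
move=> g1 Sb; rewrite Lambda_digits //.
(* With window parameter 1, the digit bound becomes exactly [|s| <= |N| - 2]. *)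
have unit1 : dual_unit R D = 1 by rewrite /dual_unit g1 /= normr1 invr1.
apply: (@is_spectrum_digits R mu N%:~R SR (mask2 Ds) 1 (dual_lattice Ds)) => //.
- exact: dual_lattice0.
- by move=> x y; exact: dual_latticeB.
- by move=> x; exact: dual_latticeMz.
- by move=> _ /SRP[k _ ->]; exact: dual_lattice_int.
- exact: mask2_ge0.
- exact: mask2_0.
- by move=> x p; exact: mask2_period.
- by move=> x; exact: (compatible_sum N0 hcomp).
- exact: mask2_cts.
- move=> _ /SRP[k kS ->]; rewrite mul1r -intr_norm -[2]/(2%:~R) -intr_norm -intrB ler_int.
  by have := Sb _ kS; lia.
- by move=> r; exact: mask2_zeros.
- move=> y y1 My k; rewrite mulrC (@mask2_small_peak _ _ y) ?oner_eq0 //.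
  by rewrite unit1.
Qed.

(** The weight for two steps of the functional equation at once, taken at x / N^2. *)
Let M2 (t : R) := mask2 Ds t * mask2 Ds (N%:~R * t).

(** On multiples of v = [dual_unit R D], the representative modulo N^2 v among -v, 0, ..., (N^2 - 2)
    v. The shift by one replaces the residue N^2 - 1, which would violate the digit bound, by -1. *)
Let red (x : R) : R :=
  (((Num.floor (x / dual_unit R D) + 1) %% (N * N))%Z - 1)%:~R * dual_unit R D.

(* With N^2 in place of N there are always at least four residues, so that the
   digits can be moved by [red] into the window required by
   [is_spectrum_digits], even when |N| = 2. *)
Lemma self_similar_spectral : spectral_measure mu.
Proof.
set v := dual_unit R D; have v0 : 0 < v := dual_unit_gt0 R D.
(* Two digits in base [N] make one in base N^2. Reduction changes it by N^2 times a dual lattice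
   point, which after division by N^2 is a period of [M2]. *)
pose S2 := [seq red (s + N%:~R * s') | s <- SR, s' <- SR].
exists (digit_sums (N%:~R * N%:~R) S2).
have NN : 4 <= `|(N%:~R * N%:~R : R)|.
  by rewrite -intrM -intr_norm -[4]/(4%:~R) ler_int normrM; nia.
have redP x : x \is a Num.int -> exists j : int, red x = x + N%:~R * N%:~R * (j%:~R * v).
  move=> xi; have : x / v \is a Num.int.
    rewrite /v /dual_unit; case: eqVneq => [_|_]; first by rewrite invr1 mulr1.
    by rewrite invrK rpredM // -intr_norm intr_int.
  rewrite intrEfloor => xv; exists (- ((Num.floor (x / v) + 1) %/ (N * N))%Z).
  have := divz_eq (Num.floor (x / v) + 1) (N * N).
  rewrite /red -/v; set m := (_ %% _)%Z; set d := (_ %/ _)%Z => e.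
  have -> : m - 1 = Num.floor (x / v) - d * (N * N) by rewrite -[Num.floor _](addrK 1) e; ring.
  rewrite intrB !intrM mulrNz (_ : (Num.floor (x / v))%:~R = x / v); last exact/eqP.
  by field; exact: lt0r_neq0.
have SRi s : s \in SR -> s \is a Num.int.
  by move=> /SRP[k _ ->]; rewrite intr_int.
have M2le1 (x : R) : mask2 Ds x <= 1 by exact: mask2_le1.
have M2P x p : dual_lattice Ds p -> M2 (x + p) = M2 x.
  move=> pP; by rewrite /M2 [_ * (x + p)]mulrDr (mask2_period _ pP) (mask2_period _ (dual_latticeMz N pP)).
apply: (@is_spectrum_digits R mu (N%:~R * N%:~R) S2 M2 v (dual_lattice Ds)) => //.
- by apply: le_trans NN; rewrite ler_nat.
- apply/allpairsP; exists (0, 0); split => //=.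
  rewrite mulr0 addr0 /red mul0r floor0 add0r.
  by rewrite modz_small ?subrr ?mul0r //; nia.
- exact: dual_lattice0.
- by move=> x y; exact: dual_latticeB.
- by move=> x; rewrite -intrM; exact: dual_latticeMz.
- by move=> _ /allpairsP[[s s'] [_ _ ->]]; exact: dual_unitP.
- by move=> x; rewrite /M2 mulr_ge0 ?mask2_ge0.
- by rewrite /M2 mulr0 mask2_0 // mulr1.
- move=> x; rewrite /S2 big_allpairs_dep /= -[RHS](compatible_sum N0 hcomp D0 x).
  rewrite big_seq [RHS]big_seq; apply: eq_bigr => s sS.
  (* One factor of [M2] depends on [s] alone, so the sum over [s'] can be evaluated first. *)
  transitivity (mask2 Ds ((x + s) / N%:~R) *
      \sum_(s' <- SR) mask2 Ds (((x + s) / N%:~R + s') / N%:~R)); last first.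
    by rewrite (compatible_sum N0 hcomp D0) mulr1.
  rewrite mulr_sumr.
  rewrite big_seq [RHS]big_seq; apply: eq_bigr => s' sS'.
  have [|j ->] := redP (s + N%:~R * s').
    by rewrite rpredD ?rpredM ?intr_int ?SRi.
  have -> : (x + (s + N%:~R * s' + N%:~R * N%:~R * (j%:~R * v))) / (N%:~R * N%:~R) =
    ((x + s) / N%:~R + s') / N%:~R + j%:~R * v by field.
  rewrite M2P; last exact: dual_unitP.
  rewrite /M2 mulrC; congr (_ * _).
  have -> : N%:~R * (((x + s) / N%:~R + s') / N%:~R) = (x + s) / N%:~R + s' by field.
  by rewrite mask2_period //; have [k _ ->] := SRP sS'; exact: dual_lattice_int.
- move=> x; apply: cvgM; first exact: mask2_cts.
  apply: continuous_cvg; first exact: mask2_cts.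
  by apply: cvgM; [exact: cvg_cst|exact: cvg_id].
- move=> x; rewrite ft_mask [in LHS](ft_mask (x / N%:~R)) mulrA; congr (_ * _).
    by rewrite /M2 mulrC; congr (mask2 _ _ * mask2 _ _); field.
  by congr (sqn (ft _ _)); field.
- move=> _ /allpairsP[[s s'] [_ _ ->]].
  rewrite /red -/v normrM (gtr0_norm v0) mulrC ler_pM2l //.
  rewrite -[2]/(2%:~R) -intrM -!intr_norm -intrB ler_int.
  set m := (_ %% _)%Z.
  have m0 : 0 <= m by apply: modz_ge0; nia.
  have m1 : m < `|N * N| by apply: ltz_mod; nia.
  have : 4 <= `|N * N| by nia.
  by lia.
- move=> r.
  (* A zero of the second factor at [x] is a zero of [mask2 Ds] at [N x]. *)
  apply: (@sub_finite_set _ _ ([set x | `|x| <= r /\ mask2 Ds x = 0] `|`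
      (fun x => x / N%:~R) @` [set x | `|x| <= `|N%:~R| * r /\ mask2 Ds x = 0])).
    move=> x [xr /eqP]; rewrite mulf_eq0 => /orP[/eqP h|/eqP h]; first by left.
    right; exists (N%:~R * x); last by field.
    by split => //; rewrite normrM ler_wpM2l.
  rewrite finite_setU; split; first exact: mask2_zeros.
  by apply: finite_image; exact: mask2_zeros.
- move=> y yv; rewrite /M2 => M1 k.
  (* Neither factor exceeds 1, so a product equal to 1 forces this. *)
  have My : mask2 Ds y = 1.
    apply/eqP; rewrite eq_le M2le1 -M1 ler_piMr ?mask2_ge0 //.
  have h := mask2_small_peak Ds0 yv My.
  by rewrite [y / _]mulrC mulrA !h mulr1 oner_eq0.
Qed.

End main.

Theorem theorem1p2 (R : realType) (N : int) (D S : {fset int})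
    (mu : probability (measurableTypeR R) R)
    (hN : (1 < `|N|)%R)
    (hmu : is_self_similar N D mu)
    (hS0 : (0 : int)%R \in S)
    (hcomp : compatible_pair (fset_scaled R N D) (fset_of_ints R S)) :
  spectral_measure mu /\
  (gcd_fset (diff_fset D) = 1%R ->
   (forall s : int, s \in S -> (2 - `|N| <= s <= `|N| - 2)%R) ->
   is_spectrum mu (Lambda N (fset_of_ints R S))).
Proof.
split; first exact: (self_similar_spectral hN hmu hS0 hcomp).
exact: Lambda_spectrum.
Qed.
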